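(* Let $n\ge3$ and let $\mu_\beta$ be an exponential random graph model on $\{0,1\}^{\mathcal I_n}$ satisfying a $\mathfrak d\text{-}\mathrm{LSI}(\sigma^2)$. There exists a constant $C=C(\sigma^2)>0$ (depending only on $\sigma^2$) such that for all $t>0$ $$\mu_\beta\left(|T_3-\mathbb E_{\mu_\beta}T_3|\ge t\right)\le2\exp\left(-\frac1C\min\left(\Big(\frac t{n^{3/2}}\Big)^{2/3},\ \frac t{\mu_1n^{3/2}},\ \Big(\frac t{\mu_2n^2}\Big)^2\right)\right)$$ and $$\mu_\beta\left(|T_3-\mathbb E_{\mu_\beta}T_3-(n-2)\mu_2f_1|\ge t\right)\le2\exp\left(-\frac1C\min\left(\Big(\frac t{n^{3/2}}\Big)^{2/3},\ \frac t{\mu_1n^{3/2}}\right)\right).$$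
   Context: $\mathcal I_n=\{(i,j):1\le i<j\le n\}$; $x\in\{0,1\}^{\mathcal I_n}$ is identified with a simple graph on $\{1,\dots,n\}$. Exponential random graph model: given $\beta=(\beta_1,\dots,\beta_s)\in\mathbb R^s$ and simple connected graphs $G_i=(V_i,E_i)$, $i=1,\dots,s$, with $G_1=K_2$, $\mu_\beta$ is the probability measure on $\{0,1\}^{\mathcal I_n}$ with $\mu_\beta(x)=Z^{-1}\exp\big(n^2\sum_{i=1}^s\beta_in^{-|V_i|}N_{G_i}(x)\big)$, where $N_{G_i}(x)$ is the number of injective maps $V_i\to\{1,\dots,n\}$ sending edges of $G_i$ to edges of $x$. For a probability measure $\mu$ on $\mathcal Y=\mathcal X^{\mathcal I}$ ($\mathcal X,\mathcal I$ finite), $\overline x_i=(x_j)_{j\ne i}$, and $f:\mathcal Y\to\mathbb R$, let $\mathfrak d_if(x)^2=\frac12\iint(f(\overline x_i,y)-f(\overline x_i,y'))^2\,d\mu(y\mid\overline x_i)\,d\mu(y'\mid\overline x_i)$ (where $\mu(\cdot\mid\overline x_i)$ is the conditional law of the $i$-th coordinate given the others) and $|\mathfrak df|^2=\sum_i(\mathfrak d_if)^2$. $\mu$ satisfies a $\mathfrak d\text{-}\mathrm{LSI}(\sigma^2)$ if $\mathrm{Ent}_\mu(f^2)\le2\sigma^2\int|\mathfrak df|^2d\mu$ for all $f:\mathcal Y\to\mathbb R$, where $\mathrm{Ent}_\mu(g)=\mathbb E_\mu g\log g-\mathbb E_\mu g\log\mathbb E_\mu g$. $\mathcal T_n$ is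 the set of all $3$-element subsets $\{e,f,g\}\subset\mathcal I_n$ forming a triangle, $T_3(x)=\sum_{\{e,f,g\}\in\mathcal T_n}x_ex_fx_g$ is the number of triangles, $\mu_1=\mathbb E_{\mu_\beta}x_e$ (for any $e\in\mathcal I_n$), $\mu_2=\mathbb E_{\mu_\beta}x_ex_f$ (for any two distinct edges $e,f\in\mathcal I_n$ sharing a vertex; by symmetry these do not depend on the choices), and $f_1(x)=\sum_{e\in\mathcal I_n}(x_e-\mathbb E_{\mu_\beta}x_e)$. *)

(* Defs.v *)
From mathcomp Require Import all_boot all_order all_algebra.
From mathcomp Require Import reals sequences exp.

Set Implicit Arguments.
Unset Strict Implicit.
Unset Printing Implicit Defensive.

Import Order.TTheory GRing.Theory Num.Theory.
Local Open Scope ring_scope.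

Record fdist (R : realType) (T : finType) := FDist {
  pmf :> T -> R;
  pmf_ge0 : forall x, 0 <= pmf x;
  pmf_sum1 : \sum_x pmf x = 1
}.

Definition Ex (R : realType) (T : finType) (mu : fdist R T) (f : T -> R) : R :=
  \sum_x mu x * f x.

Definition Pr (R : realType) (T : finType) (mu : fdist R T) (A : pred T) : R :=
  \sum_(x | A x) mu x.

(* [ln 0 = 0] in the library, so the convention [0 log 0 = 0] is built in. *)
Definition Ent (R : realType) (T : finType) (mu : fdist R T) (g : T -> R) : R :=
  Ex mu (fun x => g x * ln (g x)) - Ex mu g * ln (Ex mu g).

Section DifferenceOperator.
Variables (R : realType) (X I : finType).
Implicit Types (mu : fdist R {ffun I -> X}) (f : {ffun I -> X} -> R).

Definition upd (x : {ffun I -> X}) (i : I) (y : X) : {ffun I -> X} :=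
  [ffun j => if j == i then y else x j].

(* The conditional law of coordinate [i] given the others, at [y]; it does not
   depend on [x i].  Where the conditioning event is null, division by zero
   makes it 0; this is never seen by an integral against [mu]. *)
Definition cond_law mu (i : I) (x : {ffun I -> X}) (y : X) : R :=
  mu (upd x i y) / \sum_(z : X) mu (upd x i z).

Definition frakd_sq mu (i : I) f (x : {ffun I -> X}) : R :=
  2^-1 * \sum_(y : X) \sum_(y' : X)
    (f (upd x i y) - f (upd x i y')) ^+ 2
      * cond_law mu i x y * cond_law mu i x y'.

Definition frakd_norm_sq mu f (x : {ffun I -> X}) : R :=
  \sum_(i : I) frakd_sq mu i f x.

Definition dLSI mu (sigma2 : R) : Prop :=
  forall f, Ent mu (fun x => f x ^+ 2) <= 2 * sigma2 * Ex mu (frakd_norm_sq mu f).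

End DifferenceOperator.

Record sgraph := SGraph {
  vertex : finType;
  adj : rel vertex;
  adj_sym : symmetric adj;
  adj_irr : irreflexive adj
}.

Definition connected_graph (G : sgraph) : Prop :=
  (0 < #|vertex G|)%N /\ forall u v : vertex G, connect (@adj G) u v.

Definition graph_iso (G H : sgraph) : Prop :=
  exists2 phi : vertex G -> vertex H,
    bijective phi & forall u v, adj (phi u) (phi v) = adj u v.

Lemma neq_sym (T : eqType) : symmetric (fun u v : T => u != v).
Proof. by move=> u v; rewrite eq_sym. Qed.

Lemma neq_irr (T : eqType) : irreflexive (fun u v : T => u != v).
Proof. by move=> u; rewrite eqxx. Qed.

Definition complete_graph (m : nat) : sgraph :=
  SGraph (@neq_sym 'I_m) (@neq_irr 'I_m).

Definition inj_hom_count (G H : sgraph) : nat :=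
  #|[set phi : {ffun vertex G -> vertex H} |
      injectiveb phi
      && [forall u, forall v, adj u v ==> adj (phi u) (phi v)]]|.

(* Vertices {1, ..., n} are represented by 'I_n = {0, ..., n-1}. *)
Definition edge (n : nat) : finType := {e : 'I_n * 'I_n | (e.1 < e.2)%N}.

Definition config (n : nat) : finType := {ffun edge n -> bool}.

Definition endpoints (n : nat) (e : edge n) : {set 'I_n} :=
  [set (val e).1; (val e).2].

Definition config_adj (n : nat) (x : config n) : rel 'I_n :=
  fun u v => [exists e : edge n, x e && (endpoints e == [set u; v])].

Lemma config_adj_sym (n : nat) (x : config n) : symmetric (config_adj x).
Proof. by move=> u v; rewrite /config_adj setUC. Qed.

Lemma config_adj_irr (n : nat) (x : config n) : irreflexive (config_adj x).
Proof.
move=> u; apply/existsP => -[[[a b] /= lt_ab]] /andP[_ /eqP eq_e].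
have: a \in [set u; u] by rewrite -eq_e /endpoints /= set21.
have: b \in [set u; u] by rewrite -eq_e /endpoints /= set22.
rewrite !inE !orbb => /eqP eq_b /eqP eq_a.
by move: (lt_ab); rewrite eq_a eq_b ltnn.
Qed.

Definition config_graph (n : nat) (x : config n) : sgraph :=
  SGraph (config_adj_sym x) (config_adj_irr x).

Section ERGM.
Variables (R : realType) (n s : nat).
Variables (beta : 'I_s -> R) (G : 'I_s -> sgraph).

Definition ergm_weight (x : config n) : R :=
  expR (n%:R ^+ 2 * \sum_(i < s)
    beta i * n%:R ^- #|vertex (G i)| * (inj_hom_count (G i) (config_graph x))%:R).

Definition ergm_Z : R := \sum_(x : config n) ergm_weight x.

Lemma ergm_Z_gt0 : 0 < ergm_Z.
Proof.
rewrite /ergm_Z (bigD1 [ffun=> false]) //=; apply: ltr_pwDl; first exact: expR_gt0.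
by apply: sumr_ge0 => x _; apply: expR_ge0.
Qed.

Lemma ergm_ge0 (x : config n) : 0 <= ergm_Z^-1 * ergm_weight x.
Proof. by rewrite mulr_ge0 ?expR_ge0 // invr_ge0 ltW ?ergm_Z_gt0. Qed.

Lemma ergm_sum1 : \sum_(x : config n) ergm_Z^-1 * ergm_weight x = 1.
Proof. by rewrite -mulr_sumr mulVf // gt_eqF ?ergm_Z_gt0. Qed.

Definition ergm : fdist R (config n) := FDist ergm_ge0 ergm_sum1.

End ERGM.

Arguments ergm {R} n {s} beta G.

Definition share_vertex (n : nat) (e f : edge n) : bool :=
  (e != f) && (endpoints e :&: endpoints f != set0).

Definition triangles (n : nat) : {set {set edge n}} :=
  [set A : {set edge n} | (#|A| == 3%N)
    && [exists W : {set 'I_n}, (#|W| == 3%N)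
                               && (A == [set e | endpoints e \subset W])]].

Definition T3 (R : realType) (n : nat) (x : config n) : R :=
  \sum_(A in triangles n) \prod_(e in A) (x e)%:R.

Definition f1 (R : realType) (n : nat) (mu : fdist R (config n)) (x : config n) : R :=
  \sum_(e : edge n) ((x e)%:R - Ex mu (fun y => (y e)%:R)).

(* Main.v *)
Require Import Defs.
From mathcomp Require Import all_boot all_order all_algebra all_fingroup.
From mathcomp Require Import ring lra.
From mathcomp Require Import reals sequences exp.
Import Order.TTheory GRing.Theory Num.Theory.
Local Open Scope ring_scope.

Set Implicit Arguments.
Unset Strict Implicit.
Unset Printing Implicit Defensive.

(* With [||.||_p] the norm of [L^p(mu)] and [D_i f] the difference of [f] in
   coordinate [i], Jensen's inequality bounds [Ent (f^p)] below by
   [p * E f^p * ln (||f||_p / ||f||_(p/2))], so that the d-LSI applied to [f^(p/2)]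
   gives [||f||_p^2 <= ||f||_(p/2)^2 + O(sigma2 p) ||Df||_p^2] without differentiating
   in [p]; summing over dyadic [p] yields
   [||f - E f||_p^2 <= O(sigma2 p) ||Df||_p^2].  The Euclidean norm of a centred vector
   of functions satisfies the same bound, since its difference in a coordinate is at
   most the norm of the vector of differences.  Applying this to [T3], [D T3] and
   [D D T3], and splitting off the means [(n-2) mu2] and [mu1] of the derivatives
   (the ERGM is invariant under relabelling of the vertices), gives
   [||T3 - E T3||_p^2 <= O(p^3 n^3 + p^2 mu1^2 n^3 + p mu2^2 n^4)], where the last term
   disappears once [(n-2) mu2 f1] is subtracted.  Markov's inequality at the best
   dyadic [p] concludes. *)

(** * Elementary inequalities for powers, Euclidean norms and logarithms *)

Section RealInequalities.
Variable R : realFieldType.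

(** Young's inequality with integer exponents. The case [m], multiplied by [v], and
    [0 <= m.+1%:R * u ^+ m * (u - v) ^+ 2] add up to the next case. *)
Lemma young_pow (m : nat) (u v : R) : 0 <= u -> 0 <= v ->
  m.+1%:R * u ^+ m * v <= m%:R * u ^+ m.+1 + v ^+ m.+1.
Proof.
move=> u0 v0; elim: m => [|m IH]; first by rewrite !expr0 !expr1; lra.
have um0 : 0 <= (m.+1%:R : R) * u ^+ m * (u - v) ^+ 2.
  by rewrite mulr_ge0 ?sqr_ge0 // mulr_ge0 ?exprn_ge0.
have := ler_wpM2r v0 IH; rewrite [v ^+ m.+2]exprSr.
move: um0; rewrite [u ^+ m.+2]exprS !(exprS u m) -[m.+2]addn1 -[m.+1]addn1 !natrD.
set a := u ^+ m; set w := v ^+ _; set k := m%:R; lra.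
Qed.

(** A discrete chain rule for powers. The derivative at the larger point controls the difference;
    bounding it by a sum over both points keeps the estimate symmetric in [a] and [b]. *)
Lemma sqr_subrXX_le (m : nat) (a b : R) : 0 <= a -> 0 <= b ->
  (a ^+ m.+1 - b ^+ m.+1) ^+ 2 <=
  m.+1%:R ^+ 2 * (a - b) ^+ 2 * ((a ^+ 2) ^+ m + (b ^+ 2) ^+ m).
Proof.
move=> a0 b0; wlog ba : a b a0 b0 / b <= a.
  move=> H; case: (leP b a) => [|/ltW] ab; first exact: H.
  by rewrite -sqrrN opprB -(sqrrN (a - b)) opprB addrC [X in _ * X]addrC addrC; exact: H.
have ab : 0 <= a - b by rewrite subr_ge0.
(* Convexity of the power, which is [young_pow] rearranged. *)
have le1 : a ^+ m.+1 - b ^+ m.+1 <= m.+1%:R * a ^+ m * (a - b).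
  have := young_pow m a0 b0; rewrite mulrBr -[m.+1]addn1 natrD !exprD !expr1.
  set x := a ^+ m; set k := m%:R; lra.
have le0 : 0 <= a ^+ m.+1 - b ^+ m.+1 by rewrite subr_ge0 lerXn2r.
apply: (@le_trans _ _ ((m.+1%:R * a ^+ m * (a - b)) ^+ 2)).
  by rewrite lerXn2r ?nnegrE // (le_trans le0).
rewrite mulrAC 2!exprMn -(exprM a m) mulnC exprM.
rewrite ler_wpM2l ?mulr_ge0 ?sqr_ge0 // lerDl exprn_ge0 //; exact: sqr_ge0.
Qed.

Lemma exprDn_le (m : nat) (u v : R) : 0 <= u -> 0 <= v ->
  (u + v) ^+ m <= 2 ^+ m * (u ^+ m + v ^+ m).
Proof.
move=> u0 v0; wlog uv : u v u0 v0 / u <= v.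
  move=> H; case: (leP u v) => [|/ltW] ab; first exact: H.
  by rewrite addrC [X in _ * X]addrC; exact: H.
apply: (@le_trans _ _ ((2 * v) ^+ m)).
  by rewrite lerXn2r ?nnegrE; lra.
by rewrite exprMn ler_wpM2l ?exprn_ge0 // lerDr exprn_ge0.
Qed.

End RealInequalities.

(** The reverse triangle inequality for the Euclidean norm. It reduces to Cauchy-Schwarz, obtained
    by expanding the sum of the squares of [B * a j - A * b j]. *)
Lemma sqr_sub_sqrt_sum_le (R : rcfType) (J : finType) (a b : J -> R) :
  (Num.sqrt (\sum_j a j ^+ 2) - Num.sqrt (\sum_j b j ^+ 2)) ^+ 2 <=
  \sum_j (a j - b j) ^+ 2.
Proof.
have sq0 (c : J -> R) : 0 <= \sum_j c j ^+ 2 by apply: sumr_ge0 => j _; exact: sqr_ge0.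
set A := Num.sqrt (\sum_j a j ^+ 2); set B := Num.sqrt _.
have A2 : A ^+ 2 = \sum_j a j ^+ 2 by rewrite sqr_sqrtr.
have B2 : B ^+ 2 = \sum_j b j ^+ 2 by rewrite sqr_sqrtr.
have A0 : 0 <= A by exact: sqrtr_ge0.
have B0 : 0 <= B by exact: sqrtr_ge0.
have -> : \sum_j (a j - b j) ^+ 2 = A ^+ 2 - 2 * \sum_j a j * b j + B ^+ 2.
  rewrite A2 B2 mulr_sumr -sumrB -big_split /=; apply: eq_bigr => j _; ring.
have zero (c : J -> R) : Num.sqrt (\sum_j c j ^+ 2) = 0 -> forall j, c j = 0.
  move=> /eqP; rewrite sqrtr_eq0 => c0 j; apply/eqP; rewrite -sqrf_eq0.
  rewrite eq_le sqr_ge0 andbT.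
  by apply: le_trans c0; rewrite (bigD1 j) //= lerDl sumr_ge0 // => i _; exact: sqr_ge0.
suff CS : \sum_j a j * b j <= A * B by lra.
have [A00|An0] := eqVneq A 0.
  by rewrite big1 ?A00 ?mul0r // => j _; rewrite (zero _ A00) mul0r.
have [B00|Bn0] := eqVneq B 0.
  by rewrite big1 ?B00 ?mulr0 // => j _; rewrite (zero _ B00) mulr0.
have AB : 0 < A * B by rewrite mulr_gt0 // lt0r ?An0 ?Bn0.
rewrite -(ler_pM2l AB).
have : 0 <= \sum_j (B * a j - A * b j) ^+ 2 by exact: sq0.
have -> : \sum_j (B * a j - A * b j) ^+ 2 =
   B ^+ 2 * A ^+ 2 - 2 * (A * B * \sum_j a j * b j) + A ^+ 2 * B ^+ 2.
  rewrite [in B ^+ 2 * _]A2 [in A ^+ 2 * _]B2 !mulr_sumr -sumrB -big_split /=.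
  by apply: eq_bigr => j _; ring.
lra.
Qed.

Lemma ln_le_subr1 (R : realType) (x : R) : 0 < x -> ln x <= x - 1.
Proof.
by move=> x0; have := @le_ln1Dx R (x - 1); rewrite subrKC; apply; rewrite ltrBrDr addNr.
Qed.

(** Lets a moment be written as a power of a norm, so that later estimates involve integer powers
    only. *)
Lemma root_exists (R : realType) (m : nat) (N : R) : 0 < N ->
  exists2 A : R, 0 < A & A ^+ m.+1 = N.
Proof.
move=> N0; exists (N `^ m.+1%:R^-1); first exact: powR_gt0.
by rewrite -powR_mulrn ?powR_ge0 // -powRrM mulVf ?pnatr_eq0 // powRr1 // ltW.
Qed.

(** * Moments and entropy on a finite probability space *)

Section Expectation.
Variables (R : realType) (T : finType) (mu : fdist R T).
Implicit Types f g U V : T -> R.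

Lemma Ex_ge0 f : (forall x, 0 <= f x) -> 0 <= Ex mu f.
Proof. by move=> f0; apply: sumr_ge0 => x _; rewrite mulr_ge0 ?pmf_ge0. Qed.

Lemma le_Ex f g : (forall x, f x <= g x) -> Ex mu f <= Ex mu g.
Proof. by move=> fg; apply: ler_sum => x _; rewrite ler_wpM2l ?pmf_ge0. Qed.

Lemma eq_Ex f g : f =1 g -> Ex mu f = Ex mu g.
Proof. by move=> fg; apply: eq_bigr => x _; rewrite fg. Qed.

Lemma ExD f g : Ex mu (fun x => f x + g x) = Ex mu f + Ex mu g.
Proof. by rewrite /Ex -big_split; apply: eq_bigr => x _; rewrite mulrDr. Qed.

Lemma ExZ (c : R) f : Ex mu (fun x => c * f x) = c * Ex mu f.
Proof. by rewrite /Ex mulr_sumr; apply: eq_bigr => x _; rewrite mulrCA. Qed.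

Lemma Ex_cst (c : R) : Ex mu (fun=> c) = c.
Proof. by rewrite /Ex -mulr_suml pmf_sum1 mul1r. Qed.

Lemma ExB f g : Ex mu (fun x => f x - g x) = Ex mu f - Ex mu g.
Proof. by rewrite -mulN1r -ExZ -ExD; apply: eq_Ex => x; rewrite mulN1r. Qed.

Lemma Ex_sum (J : finType) (P : pred J) (F : J -> T -> R) :
  Ex mu (fun x => \sum_(j | P j) F j x) = \sum_(j | P j) Ex mu (F j).
Proof.
rewrite /Ex exchange_big; apply: eq_bigr => x _; by rewrite mulr_sumr.
Qed.

Lemma Ex_sq_ge f : Ex mu f ^+ 2 <= Ex mu (fun x => f x ^+ 2).
Proof.
rewrite -subr_ge0 (_ : _ - _ = Ex mu (fun x => (f x - Ex mu f) ^+ 2)).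
  by apply: Ex_ge0 => x; exact: sqr_ge0.
set c := Ex mu f.
rewrite [RHS](@eq_Ex _ (fun x => f x ^+ 2 - 2 * c * f x + c ^+ 2)); last by move=> x /=; ring.
rewrite ExD ExB ExZ Ex_cst -[Ex mu (fun x => f x)]/c. by ring.
Qed.

Lemma Ex_le_sq f (v : R) : 0 <= v ->
  Ex mu (fun x => f x ^+ 2) <= v ^+ 2 -> Ex mu f <= v.
Proof.
move=> v0 fv; rewrite leNgt; apply/negP => vf.
have := le_trans (Ex_sq_ge f) fv; rewrite leNgt => /negP; apply.
by rewrite ltrXn2r // nnegrE ltW // (le_lt_trans v0).
Qed.

(** Jensen for a dyadic exponent, by iterating the case of the square. *)
Lemma Ex_pow2_le k f (v : R) : 0 <= v ->
  Ex mu (fun x => f x ^+ (2 ^ k)) <= v ^+ (2 ^ k) -> Ex mu f <= v.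
Proof.
move=> v0; elim: k => [//|k IH] H; apply: IH; apply: Ex_le_sq; first exact: exprn_ge0.
rewrite -exprM -expnSr; apply: le_trans H.
by apply: le_Ex => x; rewrite -exprM -expnSr.
Qed.

(** Hölder with exponents (m+1)/m and m+1. Applying [young_pow] to [d * U x] and [A * V x] gives
    both factors the same norm bound [A * d], which makes the constant exact. *)
Lemma hoelder_pow (m : nat) U V (A d : R) : 0 < A -> 0 < d ->
  (forall x, 0 <= U x) -> (forall x, 0 <= V x) ->
  Ex mu (fun x => U x ^+ m.+1) <= A ^+ m.+1 ->
  Ex mu (fun x => V x ^+ m.+1) <= d ^+ m.+1 ->
  Ex mu (fun x => U x ^+ m * V x) <= A ^+ m * d.
Proof.
move=> A0 d0 U0 V0 HU HV.
have k0 : 0 < m.+1%:R * (d ^+ m * A) :> R by rewrite mulr_gt0 // mulr_gt0 // exprn_gt0.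
rewrite -(ler_pM2l k0) -ExZ.
apply: (@le_trans _ _ (Ex mu (fun x => m%:R * d ^+ m.+1 * U x ^+ m.+1
                                     + A ^+ m.+1 * V x ^+ m.+1))).
  apply: le_Ex => x.
  have := @young_pow _ m (d * U x) (A * V x); rewrite !exprMn => H.
  apply: le_trans (le_trans (H _ _) _).
  - by rewrite le_eqVlt; apply/orP; left; apply/eqP; ring.
  - by rewrite mulr_ge0 // ltW.
  - by rewrite mulr_ge0 // ltW.
  - by rewrite mulrA.
rewrite ExD !ExZ.
apply: le_trans (lerD (ler_wpM2l _ HU) (ler_wpM2l _ HV)) _.
- by rewrite mulr_ge0 // exprn_ge0 // ltW.
- by rewrite exprn_ge0 // ltW.
by rewrite le_eqVlt; apply/orP; left; apply/eqP; rewrite -[m.+1]addn1 natrD !exprD; ring.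
Qed.

(** Minkowski's inequality up to a factor 2, which only affects the final constant. *)
Lemma Ex_expD_le (m : nat) U V (u v : R) : (0 < m)%N -> 0 <= u -> 0 <= v ->
  (forall x, 0 <= U x) -> (forall x, 0 <= V x) ->
  Ex mu (fun x => U x ^+ m) <= u ^+ m ->
  Ex mu (fun x => V x ^+ m) <= v ^+ m ->
  Ex mu (fun x => (U x + V x) ^+ m) <= (2 * (u + v)) ^+ m.
Proof.
move=> m0 u0 v0 U0 V0 HU HV.
apply: (@le_trans _ _ (Ex mu (fun x => 2 ^+ m * (U x ^+ m + V x ^+ m)))).
  by apply: le_Ex => x; exact: exprDn_le.
rewrite ExZ ExD exprMn ler_wpM2l ?exprn_ge0 //.
apply: le_trans (lerD HU HV) _; case: m m0 {HU HV} => // m _.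
rewrite !(exprS _ m) mulrDl.
by apply: lerD; apply: ler_wpM2l => //; rewrite lerXn2r ?nnegrE ?addr_ge0 // ?lerDl ?lerDr.
Qed.

Lemma Pr_le1 (A : pred T) : Pr mu A <= 1.
Proof.
rewrite -(pmf_sum1 mu) /Pr [leRHS](bigID A) /= lerDl.
by apply: sumr_ge0 => x _; exact: pmf_ge0.
Qed.

Lemma markov_pow (m : nat) f (t : R) : 0 < t ->
  Pr mu (fun x => t <= `|f x|) * (t ^+ 2) ^+ m <= Ex mu (fun x => (f x ^+ 2) ^+ m).
Proof.
move=> t0; rewrite /Pr /Ex mulr_suml.
rewrite [leRHS](bigID (fun x => t <= `|f x|)) /= -[leLHS]addr0 lerD //.
  apply: ler_sum => x tx; rewrite ler_wpM2l ?pmf_ge0 //.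
  rewrite lerXn2r ?nnegrE ?sqr_ge0 // -(real_normK (num_real (f x))).
  by rewrite lerXn2r ?nnegrE // ltW.
by apply: sumr_ge0 => x _; rewrite mulr_ge0 ?pmf_ge0 // exprn_ge0 // sqr_ge0.
Qed.

Lemma Ex_gt0_of_sq (G : T -> R) : (forall x, 0 <= G x) ->
  0 < Ex mu (fun x => G x ^+ 2) -> 0 < Ex mu G.
Proof.
move=> G0 N0; rewrite lt0r Ex_ge0 // andbT; apply/negP => /eqP aE; move: N0.
rewrite /Ex big1 ?ltxx // => x _.
have := psumr_eq0P (fun x _ => mulr_ge0 (pmf_ge0 mu x) (G0 x)) aE.
by move=> /(_ x isT); rewrite expr2 mulrA => ->; rewrite mul0r.
Qed.

(* Jensen for [-ln] under the law with density [G ^+ 2 / Ex mu (G ^+ 2)]. *)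
Lemma Ent_sq_ge (G : T -> R) : (forall x, 0 <= G x) -> 0 < Ex mu (fun x => G x ^+ 2) ->
  Ex mu (fun x => G x ^+ 2) * (ln (Ex mu (fun x => G x ^+ 2)) - 2 * ln (Ex mu G))
  <= Ent mu (fun x => G x ^+ 2).
Proof.
move=> G0; rewrite /Ent; set N := Ex mu (fun x => G x ^+ 2); set a := Ex mu G => N0.
have a0 : 0 < a by exact: Ex_gt0_of_sq.
have Na0 : 0 < N / a by rewrite divr_gt0.
have : Ex mu (fun x => 2 * (ln (N / a) + 1) * G x ^+ 2 - 2 * (N / a) * G x)
       <= Ex mu (fun x => G x ^+ 2 * ln (G x ^+ 2)).
  apply: le_Ex => x; have [->|Gx] := eqVneq (G x) 0.
    by rewrite expr0n /= !(mulr0, mul0r) subr0.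
  have Gx0 : 0 < G x by rewrite lt0r Gx G0.
  have : ln (N / a / G x) <= N / a / G x - 1.
    by apply: ln_le_subr1; rewrite divr_gt0.
  rewrite ln_div ?posrE // => H.
  have -> : ln (G x ^+ 2) = 2 * ln (G x) by rewrite lnXn // mulr_natl.
  have -> : 2 * (N / a) * G x = G x ^+ 2 * (2 * (N / a / G x)) by field; rewrite Gx gt_eqF.
  have -> : 2 * (ln (N / a) + 1) * G x ^+ 2 = G x ^+ 2 * (2 * (ln (N / a) + 1)) by ring.
  by rewrite -mulrBr ler_wpM2l ?sqr_ge0 //; lra.
rewrite ExB !ExZ -/N -/a ln_div ?posrE // -[2 * (N / a) * a]mulrA divfK ?gt_eqF //.
set e := Ex mu _; lra.
Qed.

End Expectation.

(** * Moments under a log-Sobolev inequality *)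

Section ConditionalLaw.
Variables (R : realType) (X I : finType) (mu : fdist R {ffun I -> X}).
Implicit Types (x : {ffun I -> X}) (k : {ffun I -> X} -> R).

Lemma upd_upd x i y z : upd (upd x i y) i z = upd x i z.
Proof. by apply/ffunP => j; rewrite !ffunE; case: eqP. Qed.

Lemma upd_id x i : upd x i (x i) = x.
Proof. by apply/ffunP => j; rewrite !ffunE; case: eqP => [->|]. Qed.

Lemma upd_at x i y : upd x i y i = y.
Proof. by rewrite ffunE eqxx. Qed.

Lemma cond_law_ge0 i x y : 0 <= cond_law mu i x y.
Proof. by rewrite divr_ge0 ?pmf_ge0 // sumr_ge0 // => z _; exact: pmf_ge0. Qed.

Lemma cond_law_sum_le1 i x : \sum_y cond_law mu i x y <= 1.
Proof.
rewrite -mulr_suml; set Z := \sum_y _.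
by have [->|Z0] := eqVneq Z 0; rewrite ?mul0r ?divff.
Qed.

(* [(x, y) |-> (upd x i y, x i)] is an involution preserving the joint law of
   [x] and a resampled value [y]. *)
Lemma Ex_cond_law_le i k : (forall x, 0 <= k x) ->
  Ex mu (fun x => \sum_y k (upd x i y) * cond_law mu i x y) <= Ex mu k.
Proof.
move=> k0; rewrite /Ex.
under eq_bigr do rewrite mulr_sumr.
rewrite pair_big /=.
pose sw (p : {ffun I -> X} * X) := (upd p.1 i p.2, p.1 i).
have swK : involutive sw by move=> [x y]; rewrite /sw /= upd_upd upd_id upd_at.
rewrite (reindex_inj (inv_inj swK)) /= -(pair_big xpredT xpredT (fun x y =>
  mu (upd x i y) * (k (upd (upd x i y) i (x i)) * cond_law mu i (upd x i y) (x i)))) /=.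
apply: ler_sum => x _.
rewrite [leRHS]mulrC -[leRHS]mulr1.
apply: le_trans (ler_wpM2l _ (cond_law_sum_le1 i x)); last by rewrite mulr_ge0 ?pmf_ge0.
rewrite mulr_sumr le_eqVlt; apply/orP; left; apply/eqP; apply: eq_bigr => y _.
rewrite upd_upd upd_id /cond_law upd_upd upd_id.
under eq_bigr do rewrite upd_upd.
by ring.
Qed.

Section PowerEnergy.
Variables (f : {ffun I -> X} -> R) (Gam : I -> {ffun I -> X} -> R).
Hypothesis f0 : forall x, 0 <= f x.
Hypothesis Gam_local : forall i x y, Gam i (upd x i y) = Gam i x.
Hypothesis f_Gam : forall i x y y', (f (upd x i y) - f (upd x i y')) ^+ 2 <= Gam i x.

Lemma Gam_ge0 i x : 0 <= Gam i x.
Proof. exact: le_trans (sqr_ge0 _) (f_Gam i x (x i) (x i)). Qed.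

(** After [sqr_subrXX_le], the two resampled values enter through a symmetric sum, whose two halves
    cancel the factor 1/2. As [Gam i] ignores coordinate [i], it can be evaluated at the resampled
    point, and [Ex_cond_law_le] then removes the resampling. *)
Lemma Ex_frakd_pow_le (m : nat) :
  Ex mu (frakd_norm_sq mu (fun x => f x ^+ m.+1)) <=
  m.+1%:R ^+ 2 * Ex mu (fun x => (f x ^+ 2) ^+ m * \sum_i Gam i x).
Proof.
rewrite /frakd_norm_sq Ex_sum.
rewrite (@eq_Ex _ _ _ _ (fun x => \sum_i (f x ^+ 2) ^+ m * Gam i x)); last first.
  by move=> x; rewrite mulr_sumr.
rewrite Ex_sum mulr_sumr; apply: ler_sum => i _; rewrite -ExZ.
set h := fun x => m.+1%:R ^+ 2 * ((f x ^+ 2) ^+ m * Gam i x).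
have h0 x : 0 <= h x.
  by rewrite /h mulr_ge0 ?sqr_ge0 // mulr_ge0 ?Gam_ge0 // exprn_ge0 // sqr_ge0.
apply: le_trans (Ex_cond_law_le i h0); apply: le_Ex => x.
pose c := cond_law mu i x.
pose S := \sum_y h (upd x i y) * c y.
apply: (@le_trans _ _ (2^-1 * \sum_y \sum_y' (h (upd x i y) + h (upd x i y')) * c y * c y')).
  rewrite /frakd_sq ler_wpM2l ?invr_ge0 //.
  apply: ler_sum => y _; apply: ler_sum => y' _.
  rewrite ler_wpM2r ?cond_law_ge0 // ler_wpM2r ?cond_law_ge0 //.
  apply: le_trans (sqr_subrXX_le _ (f0 _) (f0 _)) _.
  rewrite /h !Gam_local -mulrDr -mulrDl -mulrA ler_wpM2l ?sqr_ge0 //.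
  by rewrite [leRHS]mulrC ler_wpM2r // addr_ge0 // exprn_ge0 // sqr_ge0.
have -> : \sum_y \sum_y' (h (upd x i y) + h (upd x i y')) * c y * c y' =
   2 * (S * \sum_y c y).
  rewrite mulrDl mul1r {1}[in RHS]mulr_suml mulr_sumr -big_split /=.
  rewrite [S]lock; under [in RHS]eq_bigr do rewrite mulr_sumr; rewrite -lock.
  rewrite (eq_bigr (fun y => (\sum_y' h (upd x i y) * c y * c y')
                     + c y * S)); last first.
    move=> y _; rewrite /S mulr_sumr -big_split /=; apply: eq_bigr => y' _; ring.
  by rewrite !big_split /= -[in X in _ = _ + X]mulr_sumr -mulr_suml [S * _]mulrC.
rewrite mulKf ?pnatr_eq0 // -[leRHS]mulr1 ler_wpM2l ?cond_law_sum_le1 //.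
by apply: sumr_ge0 => y _; rewrite mulr_ge0 ?cond_law_ge0.
Qed.

End PowerEnergy.
End ConditionalLaw.

Section Moments.
Variables (R : realType) (X I : finType) (mu : fdist R {ffun I -> X}) (s : R).
Hypotheses (s0 : 0 <= s) (lsi : dLSI mu s).

Section LocalBound.
Variables (f : {ffun I -> X} -> R) (Gam : I -> {ffun I -> X} -> R).
Hypothesis f0 : forall x, 0 <= f x.
Hypothesis Gam_local : forall i x y, Gam i (upd x i y) = Gam i x.
Hypothesis f_Gam : forall i x y y', (f (upd x i y) - f (upd x i y')) ^+ 2 <= Gam i x.

(** The d-LSI tested on [f ^+ m.+1], between the entropy bound [Ent_sq_ge] and the energy bound
    [Ex_frakd_pow_le]. *)
Lemma lsi_pow (m : nat) :
  let N := Ex mu (fun x => (f x ^+ 2) ^+ m.+1) in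
  0 < N ->
  N * (ln N - 2 * ln (Ex mu (fun x => f x ^+ m.+1))) <=
  2 * s * (m.+1%:R ^+ 2 * Ex mu (fun x => (f x ^+ 2) ^+ m * \sum_i Gam i x)).
Proof.
move=> N N0.
have NE : N = Ex mu (fun x => (f x ^+ m.+1) ^+ 2) by apply: eq_Ex => x; rewrite exprAC.
rewrite NE; apply: (le_trans (Ent_sq_ge _ _)).
- by move=> x; exact: exprn_ge0.
- by rewrite -NE.
apply: (le_trans (lsi _)); rewrite ler_wpM2l ?mulr_ge0 //.
exact: Ex_frakd_pow_le.
Qed.

(** One doubling of the exponent: [A] is the squared norm of order 2(m+1), and [B] bounds the
    squared norm of order m+1. By [lsi_pow] and Hölder, A ln(A/B) is at most [2 * s * m.+1%:R * d],
    while ln(B/A) <= B/A - 1 bounds A - B by A ln(A/B). *)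
Lemma moment_step (m : nat) (A B d : R) : 0 < A -> 0 <= B -> 0 < d ->
  Ex mu (fun x => (f x ^+ 2) ^+ m.+1) = A ^+ m.+1 ->
  Ex mu (fun x => f x ^+ m.+1) ^+ 2 <= B ^+ m.+1 ->
  Ex mu (fun x => (\sum_i Gam i x) ^+ m.+1) <= d ^+ m.+1 ->
  A <= B + 2 * s * m.+1%:R * d.
Proof.
move=> A0 B0 d0 EA EB Ed.
have Am0 : 0 < A ^+ m.+1 by exact: exprn_gt0.
set a := Ex mu _ in EB.
have a0 : 0 < a.
  apply: Ex_gt0_of_sq => [x|]; first exact: exprn_ge0.
  by rewrite (@eq_Ex _ _ _ _ (fun x => (f x ^+ 2) ^+ m.+1)) ?EA // => x; rewrite exprAC.
(* Positivity comes before [ln B], because [ln 0] is 0 here and not minus infinity. *)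
have {}B0 : 0 < B.
  rewrite lt0r B0 andbT; apply/negP => /eqP B00; move: EB.
  by rewrite B00 expr0n /= leNgt exprn_gt0.
have := @lsi_pow m; rewrite /= EA => /(_ Am0).
have U0 x : 0 <= f x ^+ 2 by exact: sqr_ge0.
have V0 x : 0 <= \sum_i Gam i x by apply: sumr_ge0 => i _; exact: Gam_ge0 f_Gam i x.
have EA' : Ex mu (fun x => (f x ^+ 2) ^+ m.+1) <= A ^+ m.+1 by rewrite EA.
have H1 := hoelder_pow A0 d0 U0 V0 EA' Ed.
have lna : 2 * ln a <= m.+1%:R * ln B.
  rewrite mulr_natl -lnXn // [leRHS]mulr_natl -lnXn // ler_ln ?posrE ?exprn_gt0 //.
have lnBA : A - B <= A * (ln A - ln B).
  have := ln_le_subr1 (divr_gt0 B0 A0); rewrite ln_div ?posrE // => /(ler_wpM2l (ltW A0)).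
  by rewrite !mulrBr mulr1 mulrCA divff ?gt_eqF // mulr1; lra.
rewrite lnXn // -[ln A *+ _]mulr_natl => H.
have {}H : A ^+ m.+1 * (m.+1%:R * (ln A - ln B)) <= 2 * s * (m.+1%:R ^+ 2 * (A ^+ m * d)).
  apply: (le_trans (le_trans _ H)).
    by rewrite ler_wpM2l ?(ltW Am0) // mulrBr lerD2l lerN2.
  by rewrite ler_wpM2l ?mulr_ge0 // ler_wpM2l ?sqr_ge0.
have k0 : 0 < A ^+ m * m.+1%:R by rewrite mulr_gt0 // exprn_gt0.
have {}H : A * (ln A - ln B) <= 2 * s * m.+1%:R * d.
  rewrite -(ler_pM2l k0); apply: le_trans (le_trans _ H) _.
    by rewrite le_eqVlt exprSr; apply/orP; left; apply/eqP; ring.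
  by rewrite le_eqVlt; apply/orP; left; apply/eqP; ring.
lra.
Qed.

(** The increments of [moment_step] are 2s2^j d for j = 1, ..., k. They form a geometric sum below
    4s2^k d, so the bound stays linear in the exponent. *)
Lemma dyadic_moment (k : nat) (d : R) : 0 < d ->
  Ex mu (fun x => (\sum_i Gam i x) ^+ (2 ^ k)) <= d ^+ (2 ^ k) ->
  Ex mu (fun x => (f x ^+ 2) ^+ (2 ^ k)) <=
    (Ex mu (fun x => f x ^+ 2) + 4 * s * (2 ^ k)%:R * d) ^+ (2 ^ k).
Proof.
move=> d0; have v0 : 0 <= Ex mu (fun x => f x ^+ 2) by apply: Ex_ge0 => x; exact: sqr_ge0.
have c0 (j : nat) : 0 <= 4 * s * (2 ^ j)%:R * d by rewrite !mulr_ge0 // ltW.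
elim: k => [_|k IH Ed].
  apply: (@le_trans _ _ (Ex mu (fun x => f x ^+ 2))); first exact: le_Ex.
  rewrite expr1 lerDl; exact: (c0 0%N).
set m := (2 ^ k.+1)%N; have [j mj] : exists j, m = j.+1.
  by exists m.-1; rewrite prednK // expn_gt0.
have c0m : 0 <= 4 * s * m%:R * d by exact: c0.
set N := Ex mu _.
have : 0 <= N by apply: Ex_ge0 => x; rewrite exprn_ge0 ?sqr_ge0.
rewrite le_eqVlt => /predU1P[<-|N0]; first by rewrite exprn_ge0 ?addr_ge0.
have [A A0 EA] := root_exists j N0.
rewrite -EA mj -{2}mj lerXn2r ?nnegrE ?addr_ge0 ?(ltW A0) //.
set B := Ex mu (fun x => f x ^+ 2) + 4 * s * (2 ^ k)%:R * d.
have B0 : 0 <= B by exact: addr_ge0.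
have := @moment_step j A B d A0 B0 d0; rewrite -mj => H.
have {H} : A <= B + 2 * s * m%:R * d.
  apply: H => //; first by rewrite {2}mj.
  have mE : m = (2 * 2 ^ k)%N by rewrite /m expnS.
  rewrite {2}mE mulnC exprM lerXn2r ?nnegrE ?exprn_ge0 //.
    by apply: Ex_ge0 => x; exact: exprn_ge0.
  apply: le_trans (IH _).
    by apply: le_Ex => x; rewrite mE exprM.
  (* The moment hypothesis on [Gam] at level k+1 implies the one at level k by Jensen. *)
  apply: Ex_le_sq; first by rewrite exprn_ge0 // ltW.
  rewrite -exprM -expnSr; apply: le_trans Ed.
  by apply: le_Ex => x; rewrite -exprM -expnSr.
move/le_trans; apply; rewrite /B /m expnS natrM; lra.
Qed.

(** The case [m = 0] of [lsi_pow]: with N the second moment and a the mean, ln(a^2/N) <= a^2/N - 1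
    turns N ln(N/a^2) into a bound on N - a^2, without linearising around constants. *)
Lemma poincare_ge0 :
  Ex mu (fun x => f x ^+ 2) - Ex mu f ^+ 2 <= 2 * s * Ex mu (fun x => \sum_i Gam i x).
Proof.
have r0 : 0 <= 2 * s * Ex mu (fun x => \sum_i Gam i x).
  rewrite !mulr_ge0 // Ex_ge0 // => x; apply: sumr_ge0 => i _; exact: Gam_ge0 f_Gam i x.
have : 0 <= Ex mu (fun x => f x ^+ 2) by apply: Ex_ge0 => x; exact: sqr_ge0.
rewrite le_eqVlt => /predU1P[<-|N0].
  by apply: le_trans r0; rewrite sub0r oppr_le0 sqr_ge0.
have := @lsi_pow 0; rewrite /= (@eq_Ex _ _ _ _ (fun x => f x ^+ 2)); last first.
  by move=> x; rewrite expr1.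
rewrite (@eq_Ex _ _ _ (fun x => f x ^+ 1) f); last by move=> x; rewrite expr1.
rewrite (@eq_Ex _ _ _ (fun x => (f x ^+ 2) ^+ 0 * _) (fun x => \sum_i Gam i x)); last first.
  by move=> x; rewrite expr0 mul1r.
move=> /(_ N0); rewrite expr1n mul1r; apply: le_trans.
set N := Ex mu _ in N0 *; have a0 : 0 < Ex mu f by exact: Ex_gt0_of_sq.
set a := Ex mu f in a0 *.
have := ln_le_subr1 (divr_gt0 (exprn_gt0 2 a0) N0).
rewrite ln_div ?posrE ?exprn_gt0 // lnXn // -mulr_natl => /(ler_wpM2l (ltW N0)).
rewrite !mulrBr mulr1 [N * (_ / N)]mulrCA divff ?gt_eqF // mulr1; lra.
Qed.

End LocalBound.

Lemma poincare (f : {ffun I -> X} -> R) (Gam : I -> {ffun I -> X} -> R) :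
  (forall i x y, Gam i (upd x i y) = Gam i x) ->
  (forall i x y y', (f (upd x i y) - f (upd x i y')) ^+ 2 <= Gam i x) ->
  Ex mu (fun x => (f x - Ex mu f) ^+ 2) <= 2 * s * Ex mu (fun x => \sum_i Gam i x).
Proof.
(* A constant shift makes the function nonnegative and changes neither the variance nor the
   differences. *)
move=> Gl fG; pose c := \sum_x `|f x|; pose g x := f x + c.
have g0 x : 0 <= g x.
  rewrite -lerBlDr sub0r lerNl; apply: (@le_trans _ _ `|f x|); first by rewrite -normrN ler_norm.
  by rewrite /c (bigD1 x) //= lerDl sumr_ge0.
apply: le_trans (@poincare_ge0 g Gam g0 Gl _); last first.
  by move=> i x y y'; rewrite /g opprD addrACA subrr addr0.
have gE : Ex mu g = Ex mu f + c by rewrite /g ExD Ex_cst.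
rewrite gE; set e := Ex mu f.
rewrite (@eq_Ex _ _ _ (fun x => g x ^+ 2)
  (fun x => (f x - e) ^+ 2 + 2 * (e + c) * f x + (c ^+ 2 - e ^+ 2))).
  by rewrite !ExD ExZ !Ex_cst -[Ex mu (fun x => f x)]/e; lra.
by move=> x; rewrite /g /=; ring.
Qed.

End Moments.

(** * Third order concentration on the discrete cube *)

Lemma dyadic_floor (R : realType) (y : R) : 1 <= y ->
  exists k, (2 ^ k)%:R <= y < 2 * (2 ^ k)%:R.
Proof.
move=> y1; have y0 : 0 <= y by exact: le_trans y1.
have n0 : (0 < Num.truncn y)%N by rewrite truncn_gt0.
have /andP[ny yn] := truncn_itv y0.
have /andP[kn nk] := trunc_log_bounds (isT : (1 < 2)%N) n0.
exists (trunc_log 2 (Num.truncn y)); apply/andP; split.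
  by apply: le_trans ny; rewrite ler_nat.
by apply: lt_le_trans yn _; rewrite -natrM -expnS ler_nat.
Qed.

(** Square the tangent bound exp(-1/2) >= 1 - 1/2. This converts a Markov bound of the form 4^(-m)
    into an exponential. *)
Lemma quarter_le_expRN1 (R : realType) : 4^-1 <= expR (- 1) :> R.
Proof.
have h : 2^-1 <= expR (- 2^-1) :> R by have := @expR_ge1Dx R (- 2^-1); lra.
have -> : expR (- 1) = expR (- 2^-1) * expR (- 2^-1) :> R by rewrite -expRD; congr expR; lra.
apply: le_trans (ler_pM _ _ h h); lra.
Qed.

Section BinaryChaos.
Variables (R : realType) (I : finType) (mu : fdist R {ffun I -> bool}) (s : R).
Local Notation Y := {ffun I -> bool}.

Definition discd (i : I) (f : Y -> R) (x : Y) : R := f (upd x i true) - f (upd x i false).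

(** Indexing by pairs allows iteration: the higher difference tensors are again finite families, and
    [sqnorm] is their squared Hilbert-Schmidt norm. *)
Definition grad (J : finType) (F : J -> Y -> R) (p : J * I) : Y -> R := discd p.2 (F p.1).

Definition sqnorm (J : finType) (F : J -> Y -> R) (x : Y) : R := \sum_j F j x ^+ 2.

Lemma sqnorm_ge0 (J : finType) (F : J -> Y -> R) x : 0 <= sqnorm F x.
Proof. by apply: sumr_ge0 => j _; exact: sqr_ge0. Qed.

Lemma sqr_upd_sub_le (i : I) (f : Y -> R) (x : Y) (y y' : bool) :
  (f (upd x i y) - f (upd x i y')) ^+ 2 <= discd i f x ^+ 2.
Proof.
by case: y; case: y'; rewrite ?subrr ?expr0n ?sqr_ge0 // -[leLHS]sqrrN opprB.
Qed.

Lemma discd_upd (i : I) (f : Y -> R) (x : Y) (y : bool) : discd i f (upd x i y) = discd i f x.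
Proof. by rewrite /discd !upd_upd. Qed.

Lemma discdB (i : I) (f g : Y -> R) (x : Y) :
  discd i (fun z => f z - g z) x = discd i f x - discd i g x.
Proof. by rewrite /discd; ring. Qed.

Hypotheses (s1 : 1 <= s) (lsi : dLSI mu s).

(** [dyadic_moment] is applied to the Euclidean norm of the centred vector. Its second moment
    contributes 2sd and the dyadic sum 4s2^k d, whence the constant 6. *)
Lemma sqnorm_centered_moment (J : finType) (F : J -> Y -> R) (k : nat) (d : R) : 0 < d ->
  Ex mu (fun x => sqnorm (grad F) x ^+ (2 ^ k)) <= d ^+ (2 ^ k) ->
  Ex mu (fun x => (\sum_j (F j x - Ex mu (F j)) ^+ 2) ^+ (2 ^ k)) <=
    (6 * s * (2 ^ k)%:R * d) ^+ (2 ^ k).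
Proof.
move=> d0 Ed; have s0 : 0 <= s by exact: le_trans s1.
pose V x := \sum_j (F j x - Ex mu (F j)) ^+ 2.
have V0 x : 0 <= V x by apply: sumr_ge0 => j _; exact: sqr_ge0.
pose Gam i x := \sum_j discd i (F j) x ^+ 2.
have GamE x : \sum_i Gam i x = sqnorm (grad F) x.
  by rewrite /Gam exchange_big /sqnorm -(pair_big xpredT xpredT (fun j i => discd i (F j) x ^+ 2)).
have Gl i x y : Gam i (upd x i y) = Gam i x.
  by apply: eq_bigr => j _; rewrite discd_upd.
have fG i x y y' : (Num.sqrt (V (upd x i y)) - Num.sqrt (V (upd x i y'))) ^+ 2 <= Gam i x.
  apply: (le_trans (sqr_sub_sqrt_sum_le _ _)); apply: ler_sum => j _.
  by rewrite opprD addrACA subrr addr0 sqr_upd_sub_le.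
have Ed' : Ex mu (fun x => (\sum_i Gam i x) ^+ (2 ^ k)) <= d ^+ (2 ^ k).
  by apply: le_trans Ed; apply: le_Ex => x; rewrite GamE.
have f0 x : 0 <= Num.sqrt (V x) by exact: sqrtr_ge0.
have fE x : Num.sqrt (V x) ^+ 2 = V x by rewrite sqr_sqrtr.
have H := dyadic_moment s0 lsi f0 Gl fG d0 Ed'.
apply: le_trans (le_trans H _).
  by apply: le_Ex => x; rewrite fE.
(* Poincaré's inequality for each entry [F j], summed over [j]. *)
have EV : Ex mu (fun x => Num.sqrt (V x) ^+ 2) <= 2 * s * d.
  apply: (@le_trans _ _ (2 * s * Ex mu (fun x => \sum_i Gam i x))); last first.
    by rewrite ler_wpM2l ?mulr_ge0 //; apply: (@Ex_pow2_le _ _ _ k) => //; exact: ltW.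
  rewrite (@eq_Ex _ _ _ _ V) // /V Ex_sum.
  rewrite (@eq_Ex _ _ _ _ (fun x => \sum_j \sum_i discd i (F j) x ^+ 2)); last first.
    by move=> x; rewrite exchange_big.
  rewrite Ex_sum mulr_sumr; apply: ler_sum => j _.
  apply: (poincare (Gam := fun i x => discd i (F j) x ^+ 2) s0 lsi) => [i x y|i x y y'].
    by rewrite discd_upd.
  exact: sqr_upd_sub_le.
have m1 : 1 <= (2 ^ k)%:R :> R by rewrite ler1n expn_gt0.
have sd0 : 0 <= s * d by rewrite mulr_ge0 // ltW.
have sdm : s * d <= s * d * (2 ^ k)%:R by rewrite ler_peMr.
rewrite lerXn2r ?nnegrE //; first 2 last.
- by apply: le_trans (lerD EV (lexx _)) _; lra.
- rewrite addr_ge0 //; first by apply: Ex_ge0 => x; exact: sqr_ge0.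
  by rewrite !mulr_ge0 // ltW.
- by rewrite !mulr_ge0 // ltW.
Qed.

Lemma sqnorm_moment (J : finType) (F : J -> Y -> R) (k : nat) (d a : R) : 0 < d ->
  \sum_j Ex mu (F j) ^+ 2 <= a ->
  Ex mu (fun x => sqnorm (grad F) x ^+ (2 ^ k)) <= d ^+ (2 ^ k) ->
  Ex mu (fun x => sqnorm F x ^+ (2 ^ k)) <= (24 * s * (2 ^ k)%:R * d + 4 * a) ^+ (2 ^ k).
Proof.
move=> d0 aE Ed; have s0 : 0 <= s by exact: le_trans s1.
have a0 : 0 <= a by apply: le_trans aE; apply: sumr_ge0 => j _; exact: sqr_ge0.
pose V x := \sum_j (F j x - Ex mu (F j)) ^+ 2.
have V0 x : 0 <= V x by apply: sumr_ge0 => j _; exact: sqr_ge0.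
have := sqnorm_centered_moment d0 Ed; rewrite -/V => EV.
set m := (2 ^ k)%N in EV *; have m0 : (0 < m)%N by rewrite expn_gt0.
(* The inner factors 2 come from z^2 <= 2(z - e)^2 + 2e^2, the outer one from [Ex_expD_le]. *)
have -> : 24 * s * m%:R * d + 4 * a = 2 * (2 * (6 * s * m%:R * d) + 2 * a) by lra.
apply: le_trans (@Ex_expD_le _ _ mu m (fun x => 2 * V x) (fun=> 2 * a) _ _ m0 _ _ _ _ _ _).
- apply: le_Ex => x; rewrite lerXn2r ?nnegrE ?sqnorm_ge0 ?addr_ge0 ?mulr_ge0 //.
  apply: (@le_trans _ _ (2 * V x + 2 * \sum_j Ex mu (F j) ^+ 2)); last first.
    by rewrite lerD2l ler_wpM2l.
  rewrite /V !mulr_sumr -big_split /=; apply: ler_sum => j _.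
  have := sqr_ge0 (F j x - 2 * Ex mu (F j)); set e := Ex _ _; set z := F j x; lra.
- by rewrite !mulr_ge0 // ltW.
- by rewrite mulr_ge0.
- by move=> x; rewrite mulr_ge0.
- by move=> x; rewrite mulr_ge0.
- rewrite (@eq_Ex _ _ _ _ (fun x => 2 ^+ m * V x ^+ m)) => [|x]; last by rewrite exprMn.
  by rewrite ExZ [leRHS]exprMn ler_wpM2l ?exprn_ge0.
- by rewrite Ex_cst.
Qed.

Section ThirdOrder.
Variables (T : Y -> R) (a1 a2 a3 : R).
Let F1 i := discd i T.
Hypotheses (a3_gt0 : 0 < a3)
  (F1E : \sum_i Ex mu (F1 i) ^+ 2 <= a1)
  (F2E : \sum_p Ex mu (grad F1 p) ^+ 2 <= a2)
  (F3E : forall x, sqnorm (grad (grad F1)) x <= a3).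

(** The recursion runs downwards: the pointwise bound on third differences controls the second ones,
    these control the first ones, and these control [T]. Each level adds the contribution of its
    means. *)
Lemma third_order_moment (k : nat) :
  Ex mu (fun x => ((T x - Ex mu T) ^+ 2) ^+ (2 ^ k)) <=
  (3456 * s ^+ 3 * ((2 ^ k)%:R ^+ 3 * a3 + (2 ^ k)%:R ^+ 2 * a2 + (2 ^ k)%:R * a1)) ^+ (2 ^ k).
Proof.
set m := (2 ^ k)%:R; have s0 : 0 <= s by exact: le_trans s1.
have a10 : 0 <= a1 by apply: le_trans F1E; apply: sumr_ge0 => j _; exact: sqr_ge0.
have a20 : 0 <= a2 by apply: le_trans F2E; apply: sumr_ge0 => j _; exact: sqr_ge0.
have m0 : 0 < m by rewrite ltr0n expn_gt0.
have s_gt0 : 0 < s by exact: lt_le_trans s1.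
have E3 : Ex mu (fun x => sqnorm (grad (grad F1)) x ^+ (2 ^ k)) <= a3 ^+ (2 ^ k).
  rewrite -[leRHS](Ex_cst mu); apply: le_Ex => x.
  by rewrite lerXn2r ?nnegrE ?sqnorm_ge0 // ltW.
have E2 := sqnorm_moment a3_gt0 F2E E3; rewrite -/m in E2.
set d2 := 24 * s * m * a3 + 4 * a2 in E2.
have d2_gt0 : 0 < d2 by rewrite ltr_pwDl ?mulr_ge0 // !mulr_gt0.
have E1 := sqnorm_moment d2_gt0 F1E E2; rewrite -/m in E1.
set d1 := 24 * s * m * d2 + 4 * a1 in E1.
have d1_gt0 : 0 < d1 by rewrite ltr_pwDl ?mulr_ge0 // !mulr_gt0.
(* [T] is viewed as a vector with a single entry. *)
have E0 := @sqnorm_centered_moment unit (fun=> T) k d1 d1_gt0.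
apply: le_trans (le_trans (E0 _) _).
- by apply: le_Ex => x; rewrite big_const card_unit /= addr0.
- apply: le_trans E1; apply: le_Ex => x.
  rewrite le_eqVlt; apply/orP; left; apply/eqP; congr (_ ^+ _).
  rewrite /sqnorm -(pair_big xpredT xpredT (fun (u : unit) i => F1 i x ^+ 2)) /=.
  by rewrite big_const card_unit /= addr0.
rewrite -/m lerXn2r ?nnegrE //.
- by rewrite !mulr_ge0 // ltW.
- by rewrite mulr_ge0 ?addr_ge0 ?mulr_ge0 ?exprn_ge0 // ltW.
rewrite /d1 /d2.
(* As [1 <= s], lower powers of [s] are absorbed into the cube; 3456 is 6 * 24 * 24. *)
have le_pow (j : nat) (z : R) : (j <= 3)%N -> 0 <= z -> s ^+ j * z <= s ^+ 3 * z.
  by move=> j3 z0; rewrite ler_wpM2r // ler_weXn2l.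
have ma20 : 0 <= m ^+ 2 * a2 by rewrite mulr_ge0 ?sqr_ge0.
have ma10 : 0 <= m * a1 by rewrite mulr_ge0 // ltW.
have := le_pow 1%N _ isT ma10; have := le_pow 2%N _ isT ma20.
have := mulr_ge0 (exprn_ge0 3 s0) ma20; have := mulr_ge0 (exprn_ge0 3 s0) ma10.
rewrite expr1; set S3 := s ^+ 3; rewrite -/S3.
have -> : 6 * s * m * (24 * s * m * (24 * s * m * a3 + 4 * a2) + 4 * a1) =
  3456 * (S3 * (m ^+ 3 * a3)) + 576 * (s ^+ 2 * (m ^+ 2 * a2)) + 24 * (s * (m * a1)).
  by rewrite /S3; ring.
lra.
Qed.

(** [eta] stands for the minimum in the exponent; each of the three conditions says that one term of
    the moment bound, at an exponent proportional to [eta], is at most a small multiple of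
    [t ^+ 2]. *)
Lemma third_order_tail (t eta : R) : 0 < t -> 0 <= eta ->
  eta ^+ 3 * a3 <= t ^+ 2 -> eta ^+ 2 * a2 <= t ^+ 2 -> eta * a1 <= t ^+ 2 ->
  Pr mu (fun x => t <= `|T x - Ex mu T|) <=
  2 * expR (- ((24 * (3456 * s ^+ 3))^-1 * eta)).
Proof.
move=> t0 eta0 H3 H2 H1.
have s0 : 0 < s by exact: lt_le_trans s1.
have a10 : 0 <= a1 by apply: le_trans F1E; apply: sumr_ge0 => j _; exact: sqr_ge0.
have a20 : 0 <= a2 by apply: le_trans F2E; apply: sumr_ge0 => j _; exact: sqr_ge0.
have mom := third_order_moment.
set K := 3456 * s ^+ 3 in mom *.
have K1 : 1 <= K by rewrite mulr_ege1 ?exprn_ege1 // ler1n.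
clearbody K; have K0 : 0 < K by exact: lt_le_trans K1.
(* With this choice each of the three terms is at most [t ^+ 2] / 12, so Markov's ratio is at most
   1/4. *)
pose L := 12 * K.
have L1 : 1 <= L by rewrite /L; lra.
have L0 : 0 < L by exact: lt_le_trans L1.
have -> : (24 * K)^-1 * eta = 2^-1 * (eta / L) by rewrite /L; field; rewrite gt_eqF.
set y := eta / L; have y0 : 0 <= y by rewrite divr_ge0 // ltW.
have etaE : eta = L * y by rewrite /y mulrCA divff ?mulr1 // gt_eqF.
(* For [y < 1] there is no dyadic exponent below [y], but then the right-hand side is at least 1. *)
have [y1|y1] := ltP y 1.
  apply: le_trans (Pr_le1 _ _) _.
  have : 2^-1 <= expR (- (2^-1 * y)) by apply: le_trans (expR_ge1Dx _); lra.
  lra.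
have [k /andP[ky yk]] := dyadic_floor y1.
set m := (2 ^ k)%:R in ky yk.
have m0 : 0 <= m :> R by exact: ler0n.
have t20 : 0 < t ^+ 2 by exact: exprn_gt0.
have M1 : L * (m * a1) <= t ^+ 2.
  by apply: le_trans H1; rewrite mulrA ler_wpM2r // etaE ler_pM2l.
have M2 : L * (m ^+ 2 * a2) <= t ^+ 2.
  apply: le_trans H2; rewrite mulrA ler_wpM2r // etaE exprMn.
  by apply: ler_pM; rewrite ?exprn_ge0 ?(ltW L0) ?lerXn2r // -{1}[L]expr1 ler_weXn2l.
have M3 : L * (m ^+ 3 * a3) <= t ^+ 2.
  apply: le_trans H3; rewrite mulrA ler_wpM2r ?(ltW a3_gt0) // etaE exprMn.
  by apply: ler_pM; rewrite ?exprn_ge0 ?(ltW L0) ?lerXn2r // -{1}[L]expr1 ler_weXn2l.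
have M : K * (m ^+ 3 * a3 + m ^+ 2 * a2 + m * a1) <= t ^+ 2 * 4^-1.
  by rewrite /L in M1 M2 M3; lra.
have P := le_trans (markov_pow mu (2 ^ k) (fun x => T x - Ex mu T) t0) (mom k).
have {}P : Pr mu (fun x => t <= `|T x - Ex mu T|) <= 4^-1 ^+ (2 ^ k).
  rewrite -(ler_pM2r (exprn_gt0 (2 ^ k) t20)); apply: (le_trans P).
  rewrite -exprMn [4^-1 * _]mulrC lerXn2r ?nnegrE //.
    by rewrite !mulr_ge0 ?addr_ge0 ?mulr_ge0 ?exprn_ge0 // ltW.
  by rewrite mulr_ge0 ?invr_ge0 // ltW.
apply: (le_trans P).
apply: (@le_trans _ _ (expR (- 1) ^+ (2 ^ k))).
  by rewrite lerXn2r ?nnegrE ?expR_ge0 ?invr_ge0 // quarter_le_expRN1.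
rewrite -expRM_natl mulrN1 -/m.
apply: (@le_trans _ _ (expR (- (2^-1 * y)))).
  by rewrite ler_expR lerN2; lra.
by have := expR_ge0 (- (2^-1 * y)); lra.
Qed.

End ThirdOrder.
End BinaryChaos.

(** * Edges, triangles and relabelling of vertices *)

Section Edges.
Variable n : nat.
Implicit Types (e f : edge n) (W P : {set 'I_n}) (p : {perm 'I_n}).

Lemma card_endpoints e : #|endpoints e| = 2%N.
Proof. by rewrite cards2; case: e => [[a b] /= ab]; rewrite neq_ltn ab. Qed.

Lemma endpoints_inj : injective (@endpoints n).
Proof.
move=> [[a b] /= ab] [[c d] /= cd]; rewrite /endpoints /= => E; apply: val_inj => /=.
have : a \in [set c; d] by rewrite -E set21.
have : b \in [set c; d] by rewrite -E set22.
rewrite !inE => /orP[] /eqP b_ /orP[] /eqP a_; subst => //.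
- by rewrite ltnn in ab.
- by have := ltn_trans ab cd; rewrite ltnn.
- by rewrite ltnn in ab.
Qed.

Lemma endpoints_surj P : #|P| = 2%N -> exists e, endpoints e = P.
Proof.
move=> /eqP/cards2P[a [b [ab ->]]].
have [lt|lt|E] := ltngtP a b.
- by exists (exist _ (a, b) lt).
- by exists (exist _ (b, a) lt); rewrite /endpoints /= setUC.
- by rewrite (val_inj E) eqxx in ab.
Qed.

(** Edges are increasing pairs and [p] may reverse the order, so the image is found through its
    endpoint set. The default [e] is never taken, by [endpoints_edge_map]. *)
Definition edge_map p e : edge n := odflt e [pick f | endpoints f == p @: endpoints e].

Lemma endpoints_edge_map p e : endpoints (edge_map p e) = p @: endpoints e.
Proof.
rewrite /edge_map; case: pickP => [f /eqP //|H].
have [f fE] : exists f, endpoints f = p @: endpoints e.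
  by apply: endpoints_surj; rewrite card_imset ?card_endpoints //; exact: perm_inj.
by have := H f; rewrite fE eqxx.
Qed.

Lemma edge_map_inj p : injective (edge_map p).
Proof.
move=> e f /(congr1 (@endpoints n)); rewrite !endpoints_edge_map => /imset_inj H.
by apply: endpoints_inj; apply: H; exact: perm_inj.
Qed.

Lemma edge_map_surj p f : exists e, edge_map p e = f.
Proof. by have [g _ gK] := injF_bij (@edge_map_inj p); exists (g f). Qed.

Definition relabel p (x : config n) : config n := [ffun e => x (edge_map p e)].

Lemma relabel_inj p : injective (relabel p).
Proof.
move=> x y /ffunP xy; apply/ffunP => f; have [e <-] := edge_map_surj p f.
by have := xy e; rewrite !ffunE.
Qed.

Lemma config_adj_relabel p (x : config n) u v :
  config_adj (relabel p x) u v = config_adj x (p u) (p v).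
Proof.
have pE : p @: [set u; v] = [set p u; p v] by rewrite imsetU1 imset_set1.
apply/existsP/existsP => -[e /andP[xe /eqP eE]].
  by exists (edge_map p e); rewrite ffunE in xe; rewrite xe endpoints_edge_map eE pE /=.
have [f fE] := edge_map_surj p e; exists f; rewrite ffunE fE xe /=; apply/eqP.
by apply: (imset_inj (@perm_inj _ p)); rewrite -endpoints_edge_map fE eE.
Qed.

(** Composition with [p] is a bijection between the two sets of maps being counted. *)
Lemma inj_hom_count_relabel (G : sgraph) p (x : config n) :
  inj_hom_count G (config_graph (relabel p x)) = inj_hom_count G (config_graph x).
Proof.
rewrite /inj_hom_count /=.
pose post (q : {perm 'I_n}) (phi : {ffun vertex G -> 'I_n}) := [ffun u => q (phi u)].
have postK q : cancel (post q) (post q^-1%g).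
  by move=> phi; apply/ffunP => u; rewrite !ffunE permK.
have postbij : bijective (post p).
  by exists (post p^-1%g) => //; rewrite -{2}[p]invgK.
rewrite -[RHS](on_card_preimset (onW_bij _ postbij)); apply: eq_card => phi.
rewrite !inE; congr (_ && _).
  apply/injectiveP/injectiveP => H u v.
    by rewrite /post !ffunE => /perm_inj/H.
  by move=> E; apply: H; rewrite /post !ffunE E.
apply: eq_forallb => u; apply: eq_forallb => v.
by rewrite config_adj_relabel /post !ffunE.
Qed.

(** The second transposition fixes the image already placed; [perm_move3] continues in the same
    way. *)
Lemma perm_move2 (a b a' b' : 'I_n) : a != b -> a' != b' ->
  exists p : {perm 'I_n}, p a = a' /\ p b = b'.
Proof.
move=> ab ab'; have [p pa] : exists p : {perm 'I_n}, p a = a'.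
  by exists (tperm a a'); rewrite tpermL.
exists (p * tperm (p b) b')%g; rewrite !permM tpermL pa; split=> //.
by apply: tpermD; rewrite eq_sym // -pa (inj_eq perm_inj).
Qed.

Lemma perm_move3 (a b c a' b' c' : 'I_n) : a != b -> a != c -> b != c ->
  a' != b' -> a' != c' -> b' != c' ->
  exists p : {perm 'I_n}, [/\ p a = a', p b = b' & p c = c'].
Proof.
move=> ab ac bc ab' ac' bc'; have [p [pa pb]] := perm_move2 ab ab'.
exists (p * tperm (p c) c')%g; rewrite !permM tpermL; split=> //.
  by rewrite tpermD // ?pa // -pa ?(inj_eq perm_inj) eq_sym // pa.
by rewrite tpermD // ?pb // -pb ?(inj_eq perm_inj) eq_sym // pb.
Qed.

Lemma edge_transitive e e' : exists p, edge_map p e = e'.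
Proof.
have /cards2P[a [b [ab eE]]] : #|endpoints e| == 2%N by rewrite card_endpoints.
have /cards2P[a' [b' [ab' eE']]] : #|endpoints e'| == 2%N by rewrite card_endpoints.
have [p [pa pb]] := perm_move2 ab ab'; exists p; apply: endpoints_inj.
by rewrite endpoints_edge_map eE eE' imsetU1 imset_set1 pa pb.
Qed.

Lemma share_vertexP e1 e2 : share_vertex e1 e2 ->
  exists a b c, [/\ a != b, a != c, b != c, endpoints e1 = [set a; b] & endpoints e2 = [set a; c]].
Proof.
move=> /andP[e12 /set0Pn[a]]; rewrite inE => /andP[a1 a2].
have other e : a \in endpoints e -> exists2 b, a != b & endpoints e = [set a; b].
  have /cards2P[u [v [uv ->]]] : #|endpoints e| == 2%N by rewrite card_endpoints.
  rewrite !inE => /orP[] /eqP ->; first by exists v.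
  by exists u; [rewrite eq_sym | rewrite setUC].
have [b ab e1E] := other e1 a1; have [c ac e2E] := other e2 a2.
exists a, b, c; split=> //; apply: contra_neq e12 => bc.
by apply: endpoints_inj; rewrite e1E e2E bc.
Qed.

Lemma share_vertex_transitive e1 e2 f1 f2 : share_vertex e1 e2 -> share_vertex f1 f2 ->
  exists p, edge_map p e1 = f1 /\ edge_map p e2 = f2.
Proof.
move=> /share_vertexP[a [b [c [ab ac bc e1E e2E]]]].
move=> /share_vertexP[a' [b' [c' [ab' ac' bc' f1E f2E]]]].
have [p [pa pb pc]] := perm_move3 ab ac bc ab' ac' bc'; exists p.
split; apply: endpoints_inj; rewrite endpoints_edge_map.
  by rewrite e1E f1E imsetU1 imset_set1 pa pb.
by rewrite e2E f2E imsetU1 imset_set1 pa pc.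
Qed.

Definition tri W : {set edge n} := [set e | endpoints e \subset W].

(** Endpoint sets identify these edges with the two-element subsets of [W]. *)
Lemma card_tri W : #|W| = 3%N -> #|tri W| = 3%N.
Proof.
move=> W3; rewrite -(card_imset _ endpoints_inj).
rewrite (_ : _ @: _ = [set P : {set 'I_n} | P \subset W & #|P| == 2%N]).
  by rewrite cards_draws W3.
apply/setP => P; rewrite inE; apply/imsetP/andP => [[e eW ->]|[PW /eqP/endpoints_surj[e eP]]].
  by rewrite inE in eW; rewrite eW card_endpoints.
by exists e => //; rewrite inE eP.
Qed.

Lemma trianglesE : triangles n = tri @: [set W : {set 'I_n} | #|W| == 3%N].
Proof.
apply/setP => A; rewrite inE; apply/andP/imsetP.
  by move=> [_ /existsP[W /andP[W3 /eqP ->]]]; exists W; rewrite // inE.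
move=> [W]; rewrite inE => W3 ->; split; first by rewrite card_tri //; exact/eqP.
by apply/existsP; exists W; rewrite W3 /=.
Qed.

(** The union lies in [W]; if it had at most two elements, both endpoint sets would equal it and the
    edges would coincide. *)
Lemma tri_two_edges W e f : #|W| = 3%N -> e != f -> e \in tri W -> f \in tri W ->
  W = endpoints e :|: endpoints f.
Proof.
move=> W3 ef; rewrite !inE => eW fW; apply/esym/eqP.
rewrite eqEcard subUset eW fW /= W3 ltnNge; apply: contra ef => U2.
have sub g : g \in [:: e; f] -> endpoints g = endpoints e :|: endpoints f.
  move=> gef; apply/eqP; rewrite eqEcard card_endpoints U2 andbT.
  by move: gef; rewrite !inE => /orP[] /eqP ->; rewrite ?subsetUl ?subsetUr.
by apply/eqP/endpoints_inj; apply: etrans (sub e _) (esym (sub f _)); rewrite !inE eqxx ?orbT.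
Qed.

Lemma card_triangle A : A \in triangles n -> #|A| = 3%N.
Proof. by rewrite inE => /andP[/eqP]. Qed.

Lemma tri_inj : {in [set W : {set 'I_n} | #|W| == 3%N] &, injective tri}.
Proof.
move=> V W; rewrite !inE => /eqP V3 /eqP W3 VW.
have : (1 < #|tri V|)%N by rewrite card_tri.
move=> /card_gt1P[e [f [eV fV ef]]].
by rewrite (tri_two_edges V3 ef eV fV) -(tri_two_edges W3 ef) -?VW.
Qed.

Lemma triangle_two_edges A B e f : A \in triangles n -> B \in triangles n ->
  e != f -> e \in A -> f \in A -> e \in B -> f \in B -> A = B.
Proof.
rewrite trianglesE => /imsetP[V]; rewrite inE => /eqP V3 -> /imsetP[W].
rewrite inE => /eqP W3 -> ef eV fV eW fW.
by rewrite (tri_two_edges V3 ef eV fV) -(tri_two_edges W3 ef eW fW).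
Qed.

Lemma triangle_share_vertex A e f : A \in triangles n ->
  e != f -> e \in A -> f \in A -> share_vertex e f.
Proof.
rewrite trianglesE => /imsetP[V]; rewrite inE => /eqP V3 -> ef eV fV.
rewrite /share_vertex ef /=; apply/negP => /eqP I0.
have := cardsUI (endpoints e) (endpoints f).
by rewrite I0 cards0 -(tri_two_edges V3 ef eV fV) V3 !card_endpoints.
Qed.

(** A triangle through [e] is determined by its third vertex. *)
Lemma card_triangles_edge e : #|[set A in triangles n | e \in A]| = (n - 2)%N.
Proof.
have c3 w : w \in ~: endpoints e -> w |: endpoints e \in [set W : {set 'I_n} | #|W| == 3%N].
  by rewrite in_setC => wN; rewrite in_set (cardsU1 w (endpoints e)) card_endpoints wN.
have -> : [set A in triangles n | e \in A] = [set tri (w |: endpoints e) | w in ~: endpoints e].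
  apply/setP => A; rewrite inE; apply/andP/imsetP.
    rewrite trianglesE => -[/imsetP[W]]; rewrite inE => W3 ->; rewrite inE => eW.
    have /cards1P[w wE] : #|W :\: endpoints e| == 1%N.
      by rewrite cardsD (setIidPr eW) (eqP W3) card_endpoints.
    exists w.
      by have : w \in W :\: endpoints e; [rewrite wE set11 | rewrite !inE => /andP[]].
    by rewrite -wE -[in LHS](setID W (endpoints e)) (setIidPr eW) setUC.
  move=> [w wN ->]; split; last by rewrite inE subsetUr.
  by rewrite trianglesE; apply: imset_f; exact: c3.
rewrite card_in_imset.
  have := cardsC (endpoints e); rewrite card_endpoints card_ord.
  by move=> /(congr1 (subn^~ 2)); rewrite addKn.
move=> v w vN wN /tri_inj => /(_ (c3 v vN) (c3 w wN)) /setP/(_ v).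
rewrite setU11 in_setU1; move: vN; rewrite in_setC => /negbTE ->.
by rewrite orbF => /esym/eqP.
Qed.

Lemma card_triangles_le : (6 * #|triangles n| <= n ^ 3)%N.
Proof.
rewrite trianglesE card_in_imset; last exact: tri_inj.
have -> : #|[set W : {set 'I_n} | #|W| == 3%N]| = 'C(n, 3).
  by rewrite card_draws card_ord.
rewrite mulnC; have -> : 6%N = (3`!)%N by [].
by rewrite bin_ffact !ffactnSr ffactn0 mul1n subn0 !expnSr expn0 mul1n !leq_mul ?leq_subr.
Qed.

End Edges.

(** * Invariance of ERGM expectations under relabelling *)

Section Symmetry.
Variables (R : realType) (n s : nat) (beta : 'I_s -> R) (G : 'I_s -> sgraph).
Let mu := ergm n beta G.

(** The weight sees a configuration only through its subgraph counts, which relabelling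
    preserves. *)
Lemma Ex_relabel (p : {perm 'I_n}) (h : config n -> R) :
  Ex mu (fun x => h (relabel p x)) = Ex mu h.
Proof.
have wE x : ergm_weight beta G (relabel p x) = ergm_weight beta G x.
  rewrite /ergm_weight; congr (expR (_ * _)); apply: eq_bigr => i _.
  by rewrite inj_hom_count_relabel.
rewrite /Ex [RHS](reindex_inj (@relabel_inj n p)); apply: eq_bigr => x _.
by rewrite /mu /= wE.
Qed.

Lemma ergm_edge_mean (e f : edge n) :
  Ex mu (fun x => (x f)%:R) = Ex mu (fun x => (x e)%:R).
Proof.
have [p pE] := edge_transitive e f.
by rewrite -(Ex_relabel p (fun x => (x e)%:R)); apply: eq_Ex => x; rewrite ffunE pE.
Qed.

Lemma ergm_cherry_mean (e1 e2 f1 f2 : edge n) :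
  share_vertex e1 e2 -> share_vertex f1 f2 ->
  Ex mu (fun x => (x f1)%:R * (x f2)%:R) = Ex mu (fun x => (x e1)%:R * (x e2)%:R).
Proof.
move=> e12 f12; have [p [p1 p2]] := share_vertex_transitive e12 f12.
rewrite -(Ex_relabel p (fun x => (x e1)%:R * (x e2)%:R)).
by apply: eq_Ex => x; rewrite !ffunE p1 p2.
Qed.

End Symmetry.

(** * Derivatives of the triangle count *)

Section Monomials.
Variables (R : realType) (I : finType).
Local Notation Y := {ffun I -> bool}.

Lemma eq_discd (f g : Y -> R) (i : I) (x : Y) : f =1 g -> discd i f x = discd i g x.
Proof. by move=> fg; rewrite /discd !fg. Qed.

Lemma discd_cst (c : R) (i : I) (x : Y) : discd i (fun=> c) x = 0.
Proof. by rewrite /discd subrr. Qed.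

Lemma discd_sum (J : finType) (P : pred J) (F : J -> Y -> R) (i : I) (x : Y) :
  discd i (fun z => \sum_(j | P j) F j z) x = \sum_(j | P j) discd i (F j) x.
Proof. by rewrite /discd sumrB. Qed.

Lemma discdZ (c : R) (f : Y -> R) (i : I) (x : Y) :
  discd i (fun z => c * f z) x = c * discd i f x.
Proof. by rewrite /discd mulrBr. Qed.

(** Hence subtracting a multiple of [f1] shifts every first derivative by the same constant. *)
Lemma discd_sum_coord (c : I -> R) (i : I) (x : Y) :
  discd i (fun z => \sum_j ((z j)%:R - c j)) x = 1.
Proof.
rewrite discd_sum (bigD1 i) //= big1 => [|j ji]; last first.
  by rewrite /discd !ffunE (negbTE ji) subrr.
by rewrite /discd !upd_at /= addr0 opprB addrA subrK subr0.
Qed.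

Definition mono (B : {set I}) (x : Y) : R := \prod_(e in B) (x e)%:R.

Lemma mono_ge0 B x : 0 <= mono B x.
Proof. by apply: prodr_ge0 => e _; exact: ler0n. Qed.

Lemma mono_le1 B x : mono B x <= 1.
Proof. by apply: prodr_ile1 => e _; rewrite ler0n lern1 leq_b1. Qed.

Lemma mono_upd_notin (B : {set I}) i x y : i \notin B -> mono B (upd x i y) = mono B x.
Proof.
move=> iB; apply: eq_bigr => e eB; rewrite ffunE; case: eqP => // ei.
by rewrite ei (negbTE iB) in eB.
Qed.

Lemma discd_mono (B : {set I}) i x : discd i (mono B) x = (i \in B)%:R * mono (B :\ i) x.
Proof.
rewrite /discd; have [iB|iB] := boolP (i \in B); last first.
  by rewrite !mono_upd_notin // subrr mul0r.
have E y : mono B (upd x i y) = y%:R * mono (B :\ i) x.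
  rewrite /mono (big_setD1 i) //= upd_at; congr (_ * _).
  by apply: mono_upd_notin; rewrite setD11.
by rewrite !E mul0r subr0.
Qed.

(** The output has the shape of the input, so the lemma iterates: [P] records the constraints from
    coordinates already differentiated, and [B] the variables that remain. *)
Lemma discd_sum_mono (T : {set {set I}}) (P : pred {set I}) (B : {set I} -> {set I}) i x :
  discd i (fun z => \sum_(A in T) (P A)%:R * mono (B A) z) x =
  \sum_(A in T) (P A && (i \in B A))%:R * mono (B A :\ i) x.
Proof.
rewrite discd_sum; apply: eq_bigr => A _.
by rewrite discdZ discd_mono mulrA -natrM mulnb.
Qed.

Lemma sum_indicator (b : bool) (B : {set I}) :
  \sum_(j : I) (b && (j \in B))%:R = (b * #|B|)%:R :> R.
Proof.
case: b => /=; last by rewrite big1.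
by rewrite mul1n -sum1_card natr_sum [RHS]big_mkcond; apply: eq_bigr => j _; case: (j \in B).
Qed.

Lemma sum_indicator_le1 (T : finType) (S : {set T}) (P : pred T) :
  (forall a b, a \in S -> b \in S -> P a -> P b -> a = b) ->
  \sum_(a in S) (P a)%:R <= 1 :> R.
Proof.
move=> H; have -> : \sum_(a in S) (P a)%:R = #|[set a in S | P a]|%:R :> R.
  rewrite -sum1_card natr_sum big_mkcond [RHS]big_mkcond; apply: eq_bigr => a _.
  by rewrite inE; case: (a \in S); case: (P a).
rewrite lern1; apply/card_le1_eqP => a b; rewrite !inE => /andP[aS Pa] /andP[bS Pb].
exact: H.
Qed.

End Monomials.

Lemma frakd_norm_sq_ge0 (R : realType) (X I : finType) (mu : fdist R {ffun I -> X})
  (f : {ffun I -> X} -> R) x : 0 <= frakd_norm_sq mu f x.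
Proof.
apply: sumr_ge0 => i _; rewrite mulr_ge0 ?invr_ge0 //.
apply: sumr_ge0 => y _; apply: sumr_ge0 => y' _.
by rewrite mulr_ge0 ?cond_law_ge0 // mulr_ge0 ?cond_law_ge0 ?sqr_ge0.
Qed.

Lemma dLSI_le (R : realType) (X I : finType) (mu : fdist R {ffun I -> X}) (s s' : R) :
  s <= s' -> dLSI mu s -> dLSI mu s'.
Proof.
move=> ss lsi f; apply: (le_trans (lsi f)); rewrite ler_wpM2r ?ler_wpM2l //.
by apply: Ex_ge0 => x; exact: frakd_norm_sq_ge0.
Qed.

Section TriangleDerivatives.
Variables (R : realType) (n : nat).
Local Notation T3 := (@T3 R n).
Local Notation tr := (triangles n).
Let P2 (i j : edge n) (A : {set edge n}) := (i \in A) && (j \in A :\ i).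
Let P3 (i j k : edge n) (A : {set edge n}) := P2 i j A && (k \in A :\ i :\ j).

Lemma discd_T3 i x : discd i T3 x = \sum_(A in tr) (i \in A)%:R * mono R (A :\ i) x.
Proof.
rewrite (@eq_discd _ _ _ (fun x => \sum_(A in tr) (true)%:R * mono R A x)).
  exact: discd_sum_mono.
by move=> z; apply: eq_bigr => A _; rewrite mul1r.
Qed.

Lemma discd2_T3 p x : grad (fun i => discd i T3) p x =
  \sum_(A in tr) (P2 p.1 p.2 A)%:R * mono R (A :\ p.1 :\ p.2) x.
Proof. by rewrite /grad (eq_discd _ _ (discd_T3 _)) discd_sum_mono. Qed.

Lemma discd3_T3 p x : grad (grad (fun i => discd i T3)) p x =
  \sum_(A in tr) (P3 p.1.1 p.1.2 p.2 A)%:R * mono R (A :\ p.1.1 :\ p.1.2 :\ p.2) x.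
Proof. by rewrite {1}/grad (eq_discd _ _ (discd2_T3 _)) discd_sum_mono. Qed.

Lemma cardD1_triangle i (A : {set edge n}) : A \in tr -> i \in A -> #|A :\ i| = 2%N.
Proof. by move=> /card_triangle; rewrite (cardsD1 i) => + iA; rewrite iA => -[]. Qed.

Lemma cardD2_triangle i j (A : {set edge n}) : A \in tr -> P2 i j A -> #|A :\ i :\ j| = 1%N.
Proof.
move=> At /andP[iA jA]; have := cardD1_triangle At iA.
by rewrite (cardsD1 j) jA => -[].
Qed.

Lemma sum_P2_le1 i j : \sum_(A in tr) (P2 i j A)%:R <= 1 :> R.
Proof.
apply: sum_indicator_le1 => A B At Bt /andP[iA]; rewrite in_setD1 => /andP[ji jA].
move=> /andP[iB]; rewrite in_setD1 => /andP[_ jB].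
exact: (triangle_two_edges At Bt ji).
Qed.

(** Each triangle has 3 * 2 = 6 ordered pairs of distinct edges, and [card_triangles_le] bounds six
    times their number. *)
Lemma sum_P2 : \sum_p \sum_(A in tr) (P2 p.1 p.2 A)%:R <= n%:R ^+ 3 :> R.
Proof.
rewrite exchange_big /=.
rewrite (eq_bigr (fun=> 6%:R)); last first.
  move=> A At.
  rewrite -(pair_big xpredT xpredT (fun i j => (P2 i j A)%:R)) /=.
  rewrite (eq_bigr (fun i => (true && (i \in A))%:R * 2%:R)); last first.
    move=> i _; rewrite sum_indicator /=.
    have [iA|] := boolP (i \in A); last by rewrite mul0n mul0r.
    by rewrite (cardD1_triangle At iA) mul1n mul1r.
  by rewrite -mulr_suml sum_indicator (card_triangle At) mul1n; lra.
by rewrite sumr_const -mulrnA -natrX ler_nat card_triangles_le.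
Qed.

Lemma sum_P3 : \sum_p \sum_(A in tr) (P3 p.1.1 p.1.2 p.2 A)%:R <= n%:R ^+ 3 :> R.
Proof.
apply: le_trans sum_P2; rewrite exchange_big [leRHS]exchange_big /=.
apply: ler_sum => A At.
rewrite -(pair_big xpredT xpredT (fun q k => (P3 q.1 q.2 k A)%:R)) /=.
apply: ler_sum => q _; rewrite sum_indicator.
by case Pq: (P2 _ _ _); rewrite ?mul0n // (cardD2_triangle At Pq).
Qed.

(** Two distinct edges lie in at most one triangle, so every entry is in [0, 1] and its square is at
    most the entry. What remains is the count of ordered edge triples in [sum_P3]. *)
Lemma sqnorm_discd3_T3 x : sqnorm (grad (grad (fun i => discd i T3))) x <= n%:R ^+ 3.
Proof.
apply: le_trans sum_P3; apply: ler_sum => p _; rewrite discd3_T3.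
set S := \sum_(A in tr) _ * _; set N := \sum_(A in tr) _.
have S0 : 0 <= S by apply: sumr_ge0 => A _; rewrite mulr_ge0 ?ler0n ?mono_ge0.
have SN : S <= N.
  by apply: ler_sum => A _; rewrite ler_piMr ?ler0n ?mono_le1.
have N1 : N <= 1.
  apply: le_trans (sum_P2_le1 p.1.1 p.1.2); apply: ler_sum => A _.
  by rewrite /P3; case: (P2 _ _ _); case: (_ \in _).
by apply: le_trans (SN); rewrite expr2 ler_piMr // (le_trans SN).
Qed.

End TriangleDerivatives.

(** * Means of the derivatives of the triangle count under the ERGM *)

Section ErgmTriangles.
Variables (R : realType) (n s : nat) (beta : 'I_s -> R) (G : 'I_s -> sgraph).
Variables (e e1 e2 : edge n).
Hypotheses (n3 : (3 <= n)%N) (e12 : share_vertex e1 e2).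
Local Notation mu := (ergm n beta G).
Local Notation T3 := (@T3 R n).
Local Notation mu1 := (Ex mu (fun x => (x e)%:R)).
Local Notation mu2 := (Ex mu (fun x => (x e1)%:R * (x e2)%:R)).

(** Each of the n - 2 triangles through [i] leaves two edges sharing a vertex, whose product has
    mean [mu2] by symmetry. *)
Lemma Ex_discd_T3 i : Ex mu (discd i T3) = (n%:R - 2) * mu2.
Proof.
rewrite (eq_Ex _ (discd_T3 R i)) Ex_sum.
rewrite (eq_bigr (fun A : {set edge n} => (i \in A)%:R * mu2)); last first.
  move=> A At; rewrite ExZ; have [iA|] := boolP (i \in A); last by rewrite !mul0r.
  congr (_ * _); have /eqP/cards2P[f [g [fg fgE]]] := cardD1_triangle At iA.
  have mE x : mono R (A :\ i) x = (x f)%:R * (x g)%:R.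
    by rewrite /mono fgE big_setU1 ?big_set1 // inE.
  rewrite (eq_Ex _ mE); apply: ergm_cherry_mean => //.
  have fA : f \in A :\ i by rewrite fgE set21.
  have gA : g \in A :\ i by rewrite fgE set22.
  move: fA gA; rewrite !in_setD1 => /andP[_ fA] /andP[_ gA].
  exact: triangle_share_vertex fg fA gA.
rewrite -mulr_suml; congr (_ * _); rewrite -natrB ?(ltnW n3) // -(card_triangles_edge i).
rewrite -sum1_card natr_sum big_mkcond [RHS]big_mkcond; apply: eq_bigr => A _.
by rewrite inE; case: (A \in _); case: (i \in A).
Qed.

Lemma sum_sqr_Ex_discd_T3_le :
  \sum_i Ex mu (discd i T3) ^+ 2 <= mu2 ^+ 2 * n%:R ^+ 4.
Proof.
rewrite (eq_bigr (fun=> ((n%:R - 2) * mu2) ^+ 2)) => [|i _]; last by rewrite Ex_discd_T3.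
rewrite sumr_const -[_ *+ #|_|]mulr_natr exprMn mulrAC mulrC ler_wpM2l ?sqr_ge0 //.
have cE : (#|edge n| <= n ^ 2)%N.
  rewrite card_sig; apply: leq_trans (max_card _) _.
  by rewrite card_prod card_ord mulnn.
rewrite -[4%N]/(2 + 2)%N exprD; apply: ler_pM; rewrite ?sqr_ge0 //.
  rewrite lerXn2r ?nnegrE ?subr_ge0 ?ler_nat ?(ltnW n3) //.
  by rewrite gerBl.
by rewrite -natrX ler_nat.
Qed.

(** An entry has mean [mu1 * N], where [N] counts the triangles through both edges. As [N] is at
    most 1, [N ^+ 2 <= N], and [sum_P2] applies. *)
Lemma sum_sqr_Ex_discd2_T3_le :
  \sum_p Ex mu (grad (fun i => discd i T3) p) ^+ 2 <= mu1 ^+ 2 * n%:R ^+ 3.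
Proof.
apply: le_trans (ler_wpM2l (sqr_ge0 _) (sum_P2 R n)); rewrite mulr_sumr.
apply: ler_sum => p _.
set N := \sum_(A in _) _.
have N0 : 0 <= N by apply: sumr_ge0 => A _; exact: ler0n.
have N1 : N <= 1 by exact: sum_P2_le1.
have -> : Ex mu (grad (fun i => discd i T3) p) = mu1 * N.
  rewrite (eq_Ex _ (discd2_T3 R p)) Ex_sum mulr_sumr; apply: eq_bigr => A At.
  rewrite ExZ mulrC; case PA: (_ && _); last by rewrite !mulr0.
  congr (_ * _); have /eqP/cards1P[f fE] := cardD2_triangle At PA.
  rewrite -(ergm_edge_mean beta G e f); apply: eq_Ex => x.
  by rewrite /mono fE big_set1.
by rewrite exprMn ler_wpM2l ?sqr_ge0 // expr2 ler_piMr.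
Qed.

End ErgmTriangles.

(** * From the terms of the minimum to the polynomial conditions of the tail bound *)

Section Thresholds.
Variables (R : realType) (n : nat) (t eta : R).
Hypotheses (t0 : 0 < t) (n0 : (0 < n)%N) (eta0 : 0 <= eta).
Let n32 : R := n%:R `^ (3 / 2).

Lemma n32_sqr : n32 ^+ 2 = n%:R ^+ 3.
Proof.
rewrite /n32 -powR_mulrn ?powR_ge0 // -powRrM -[RHS]powR_mulrn ?ler0n //.
by congr (_ `^ _); lra.
Qed.

Lemma threshold3 : eta <= (t / n32) `^ (2 / 3) -> eta ^+ 3 * n%:R ^+ 3 <= t ^+ 2.
Proof.
have n320 : 0 < n32 by rewrite powR_gt0 // ltr0n.
move=> H; have q0 : 0 <= t / n32 by rewrite divr_ge0 // ltW.
have {H} : eta ^+ 3 <= ((t / n32) `^ (2 / 3)) ^+ 3 by rewrite lerXn2r ?nnegrE ?powR_ge0.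
rewrite -[leRHS]powR_mulrn ?powR_ge0 // -powRrM.
have -> : (2 / 3 * 3 : R) = 2%:R by lra.
by rewrite powR_mulrn // expr_div_n n32_sqr ler_pdivlMr // exprn_gt0 // ltr0n.
Qed.

Lemma threshold2 (m1 : R) : 0 <= m1 -> eta <= t / (m1 * n32) ->
  eta ^+ 2 * (m1 ^+ 2 * n%:R ^+ 3) <= t ^+ 2.
Proof.
have n320 : 0 < n32 by rewrite powR_gt0 // ltr0n.
(* If [m1] is 0, the quotient by it carries no information, but the left-hand side of the goal
   vanishes. *)
rewrite le_eqVlt => /predU1P[<- _|m10 H].
  by rewrite expr0n /= mul0r mulr0 sqr_ge0.
have tn : eta * (m1 * n32) <= t by rewrite -ler_pdivlMr // mulr_gt0.
rewrite -n32_sqr -!exprMn lerXn2r ?nnegrE ?(ltW t0) //.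
by rewrite mulr_ge0 // mulr_ge0 // ltW.
Qed.

Lemma threshold1 (m2 : R) : 0 <= m2 -> eta <= (t / (m2 * n%:R ^+ 2)) ^+ 2 ->
  eta * (m2 ^+ 2 * n%:R ^+ 4) <= t ^+ 2.
Proof.
rewrite le_eqVlt => /predU1P[<- _|m20].
  by rewrite expr0n /= mul0r mulr0 sqr_ge0.
have k0 : 0 < m2 * n%:R ^+ 2 by rewrite mulr_gt0 // exprn_gt0 // ltr0n.
rewrite expr_div_n ler_pdivlMr ?exprn_gt0 // exprMn -exprM.
exact.
Qed.

End Thresholds.

Unset Implicit Arguments.

Theorem theorem3p2 (R : realType) (sigma2 : R) (hsigma2 : 0 <= sigma2) :
  exists2 C : R, 0 < C &
  forall (n s : nat) (beta : 'I_s.+1 -> R) (G : 'I_s.+1 -> sgraph),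
    (3 <= n)%N ->
    (forall i, connected_graph (G i)) ->
    graph_iso (G ord0) (complete_graph 2%N) ->
    let mu := ergm n beta G in
    dLSI mu sigma2 ->
    forall e e1 e2 : edge n, share_vertex e1 e2 ->
    let mu1 := Ex mu (fun x => (x e)%:R) in
    let mu2 := Ex mu (fun x => (x e1)%:R * (x e2)%:R) in
    let ET3 := Ex mu (@T3 R n) in
    let n32 := n%:R `^ (3 / 2) in
    forall t : R, 0 < t ->
      Pr mu (fun x => t <= `|T3 R x - ET3|)
        <= 2 * expR (- (C^-1 *
             Num.min ((t / n32) `^ (2 / 3))
               (Num.min (t / (mu1 * n32)) ((t / (mu2 * n%:R ^+ 2)) ^+ 2))))
      /\
      Pr mu (fun x => t <= `|T3 R x - ET3 - (n%:R - 2) * mu2 * f1 mu x|)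
        <= 2 * expR (- (C^-1 *
             Num.min ((t / n32) `^ (2 / 3)) (t / (mu1 * n32)))).
Proof.
(* The d-LSI is weakened to a constant that is at least 1, so that a single power of [s] dominates
   in the tail bound. *)
set s := sigma2 + 1; have s1 : 1 <= s by rewrite lerDr.
exists (24 * (3456 * s ^+ 3)).
  by rewrite mulr_gt0 ?ltr0n // mulr_gt0 ?ltr0n // exprn_gt0 // (lt_le_trans ltr01).
move=> n k beta G n3 _ _ mu lsi0 e e1 e2 e12 mu1 mu2 ET3 n32 t t0.
have lsi : dLSI mu s by apply: dLSI_le lsi0; rewrite lerDl.
have n0 : (0 < n)%N by exact: leq_trans n3.
have a3 : 0 < n%:R ^+ 3 :> R by rewrite exprn_gt0 // ltr0n.
have mu10 : 0 <= mu1 by apply: Ex_ge0 => x; exact: ler0n.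
have mu20 : 0 <= mu2 by apply: Ex_ge0 => x; rewrite -natrM ler0n.
have q3 : 0 <= (t / n32) `^ (2 / 3) by exact: powR_ge0.
have q2 : 0 <= t / (mu1 * n32) by rewrite divr_ge0 ?(ltW t0) // mulr_ge0 // powR_ge0.
have q1 : 0 <= (t / (mu2 * n%:R ^+ 2)) ^+ 2 by exact: sqr_ge0.
have E2 := sum_sqr_Ex_discd2_T3_le beta G e.
split.
  set eta := Num.min _ _.
  have eta0 : 0 <= eta by rewrite !le_min q3 q2 q1.
  have : eta <= eta by []; rewrite {2}/eta !le_min => /and3P[eta3 eta2 eta1].
  have E1 := sum_sqr_Ex_discd_T3_le beta G n3 e12.
  apply: (third_order_tail s1 lsi a3 E1 E2 (@sqnorm_discd3_T3 R n) t0 eta0).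
  - exact: threshold3.
  - exact: threshold2.
  - exact: threshold1.
set eta := Num.min _ _.
have eta0 : 0 <= eta by rewrite !le_min q3 q2.
have : eta <= eta by []; rewrite {2}/eta !le_min => /andP[eta3 eta2].
set c := (n%:R - 2) * mu2.
(* The correction centres all first derivatives and leaves the higher ones unchanged, so the tail
   bound applies with [a1 = 0]. *)
pose T (x : config n) : R := T3 R x - c * f1 mu x.
have discd_T i x : discd i T x = discd i (@T3 R n) x - c.
  by rewrite discdB discdZ /f1 discd_sum_coord mulr1.
have discd2_T p x : grad (fun i => discd i T) p x = grad (fun i => discd i (@T3 R n)) p x.
  by rewrite /grad (eq_discd _ _ (discd_T _)) discdB discd_cst subr0.
have Ef1 : Ex mu (f1 mu) = 0.
  by rewrite /f1 Ex_sum big1 // => i _; rewrite ExB Ex_cst subrr.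
have ET : Ex mu T = ET3 by rewrite /T ExB ExZ Ef1 mulr0 subr0.
have tail := @third_order_tail _ _ mu s s1 lsi T 0 (mu1 ^+ 2 * n%:R ^+ 3) (n%:R ^+ 3) a3.
have -> : Pr mu (fun x => t <= `|T3 R x - ET3 - c * f1 mu x|) =
          Pr mu (fun x => t <= `|T x - Ex mu T|).
  by apply: eq_bigl => x; rewrite ET /T addrAC.
apply: tail => //.
- rewrite big1 // => i _; rewrite (eq_Ex _ (discd_T i)) ExB Ex_cst.
  by rewrite (Ex_discd_T3 beta G n3 e12) subrr expr0n.
- apply: le_trans E2; rewrite le_eqVlt; apply/orP; left; apply/eqP.
  by apply: eq_bigr => p _; rewrite (eq_Ex _ (discd2_T p)).
- move=> x; apply: le_trans (sqnorm_discd3_T3 R x); rewrite le_eqVlt; apply/orP; left.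
  by apply/eqP; apply: eq_bigr => p _; rewrite {1}/grad (eq_discd _ _ (discd2_T _)).
- exact: threshold3.
- exact: threshold2.
- by rewrite mulr0 sqr_ge0.
Qed.
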